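(* Let $A$ and $B$ be finite-dimensional Hilbert spaces. For any $\sigma\in\mathrm{P}(A)$ and any $\mathcal{N}\in\mathrm{TPCP}(A,B)$ there exists a recovery map $\widetilde{\mathcal{R}}_{\sigma,\mathcal{N}}\in\mathrm{R}_{\sigma,\mathcal{N}}$ such that for all $\rho\in\mathrm{S}_\sigma(A)$ \[ D(\rho\|\sigma)-D\bigl(\mathcal{N}(\rho)\|\mathcal{N}(\sigma)\bigr)\ \ge\ D_{\mathbb{M}}\bigl(\rho\,\big\|\,(\widetilde{\mathcal{R}}_{\sigma,\mathcal{N}}\circ\mathcal{N})(\rho)\bigr)\ \ge\ -2\log F\bigl(\rho,(\widetilde{\mathcal{R}}_{\sigma,\mathcal{N}}\circ\mathcal{N})(\rho)\bigr). \]
   Context: $\mathrm{S}(A)$: density operators on $A$; $\mathrm{P}(A)$: non-negative operators on $A$; $\mathrm{TPCP}(A,B)$: quantum channels. $\mathrm{S}_\sigma(A):=\{\rho\in\mathrm{S}(A):\mathrm{supp}(\rho)\subseteq\mathrm{supp}(\sigma)\}$. $D(\rho\|\sigma):=\mathrm{tr}(\rho(\log\rho-\log\sigma))$ if $\mathrm{supp}(\rho)\subseteq\mathrm{supp}(\sigma)$, $+\infty$ otherwise. $F(\rho,\tau):=\|\sqrt\rho\sqrt\tau\|_1$. The measured relative entropy is $D_{\mathbb{M}}(\rho\|\tau):=\sup D(\mathcal{M}(\rho)\|\mathcal{M}(\tau))$, the supremum over all POVMs $\{M_x\}$ (finite, $\sum_x M_x=\mathrm{id}$), where $\mathcal{M}(\omega)=\sum_x\mathrm{tr}(\omega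 M_x)|x\rangle\langle x|$ for an orthonormal set $\{|x\rangle\}$. The Petz map (on the support of $\mathcal{N}(\sigma)$, inverses on supports) is $\mathcal{P}_{\sigma,\mathcal{N}}(X_B)=\sigma^{1/2}\mathcal{N}^\dagger(\mathcal{N}(\sigma)^{-1/2}X_B\mathcal{N}(\sigma)^{-1/2})\sigma^{1/2}$. For unitaries $U$ on $B$ commuting with $\mathcal{N}(\sigma)$ and $V$ on $A$ commuting with $\sigma$, let $\mathcal{R}^{U,V}_{\sigma,\mathcal{N}}:X_B\mapsto V\,\mathcal{P}_{\sigma,\mathcal{N}}(UX_BU^\dagger)\,V^\dagger$, and let $\mathrm{R}_{\sigma,\mathcal{N}}$ be the convex hull of all such maps $\mathcal{R}^{U,V}_{\sigma,\mathcal{N}}$. *)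

(* Defs.v *)
From HB Require Import structures.
From mathcomp Require Import all_boot all_order all_algebra.
From mathcomp Require Import sesquilinear spectral.
From mathcomp Require Import complex mxtens.
From mathcomp Require Import classical_sets boolp reals ereal exp.
Set Implicit Arguments.
Unset Strict Implicit.
Unset Printing Implicit Defensive.
Import Order.TTheory GRing.Theory Num.Theory.
Local Open Scope ring_scope.

Section QInfo.
Variable R : realType.
Local Notation C := (R[i]).

Definition adj {m n} (X : 'M[C]_(m, n)) : 'M[C]_(n, m) := map_mx Num.conj (X^T).

Definition psd {n} (A : 'M[C]_n) : Prop :=
  adj A = A /\ forall v : 'cV[C]_n, 0 <= (adj v *m A *m v) 0 0.

Definition density {n} (rho : 'M[C]_n) : Prop := psd rho /\ \tr rho = 1.

(* supp(rho) <= supp(sigma), supports being orthocomplements of kernels *)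
Definition supp_le {n} (rho sigma : 'M[C]_n) : Prop :=
  forall v : 'cV[C]_n, sigma *m v = 0 -> rho *m v = 0.

Definition unitary {n} (U : 'M[C]_n) : Prop := U *m adj U = 1%:M.

(* functional calculus of a normal (here: Hermitian) matrix via the spectral
   decomposition A = P^-1 diag(sp) P, P unitary *)
Definition mxfun {n} (f : C -> C) (A : 'M[C]_n) : 'M[C]_n :=
  invmx (spectralmx A) *m diag_mx (map_mx f (spectral_diag A)) *m spectralmx A.

(* logarithm on the support (eigenvalue 0 mapped to 0, i.e. 0 log 0 = 0) *)
Definition logC (z : C) : C :=
  if 0 < z then (ln (complex.Re z))%:C%C else 0.
Definition sqrtC' (z : C) : C :=
  if 0 <= z then (Num.sqrt (complex.Re z))%:C%C else 0.
Definition invsqrtC (z : C) : C :=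
  if 0 < z then ((Num.sqrt (complex.Re z))^-1)%:C%C else 0.

Definition mxlog {n} (A : 'M[C]_n) := mxfun logC A.
Definition mxsqrt {n} (A : 'M[C]_n) := mxfun sqrtC' A.
Definition mxinvsqrt {n} (A : 'M[C]_n) := mxfun invsqrtC A.

Definition relent {n} (rho sigma : 'M[C]_n) : \bar R :=
  if `[< supp_le rho sigma >] then
    (complex.Re (\tr (rho *m (mxlog rho - mxlog sigma))))%:E
  else +oo%E.

Definition trnorm {n} (X : 'M[C]_n) : R := complex.Re (\tr (mxsqrt (adj X *m X))).
Definition fidelity {n} (rho tau : 'M[C]_n) : R := trnorm (mxsqrt rho *m mxsqrt tau).

Definition neg2logF {n} (rho tau : 'M[C]_n) : \bar R :=
  if 0 < fidelity rho tau then (- 2 * ln (fidelity rho tau))%:E else +oo%E.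

Definition povm {n k} (M : 'I_k -> 'M[C]_n) : Prop :=
  (forall x, psd (M x)) /\ \sum_(x < k) M x = 1%:M.
Definition measure_ch {n k} (M : 'I_k -> 'M[C]_n) (w : 'M[C]_n) : 'M[C]_k :=
  diag_mx (\row_(x < k) \tr (w *m M x)).

Definition meas_relent {n} (rho tau : 'M[C]_n) : \bar R :=
  ereal_sup [set d | exists (k : nat) (M : 'I_k -> 'M[C]_n),
                       povm M /\ d = relent (measure_ch M rho) (measure_ch M tau)].

Definition linear_map {n m} (N : 'M[C]_n -> 'M[C]_m) : Prop :=
  forall (a : C) X Y, N (a *: X + Y) = a *: N X + N Y.

(* (id_k (x) N) acting on a k x k block matrix with n x n blocks *)
Definition ampliate {n m} k (N : 'M[C]_n -> 'M[C]_m) (X : 'M[C]_(k * n)) : 'M[C]_(k * m) :=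
  \matrix_(p, q)
    let: (i, a) := mxtens_unindex p in let: (j, b) := mxtens_unindex q in
    N (\matrix_(c, d) X (mxtens_index (i, c)) (mxtens_index (j, d))) a b.

Definition tpcp {n m} (N : 'M[C]_n -> 'M[C]_m) : Prop :=
  [/\ linear_map N,
      forall X, \tr (N X) = \tr X &
      forall k (X : 'M[C]_(k * n)), psd X -> psd (ampliate N X)].

(* Hilbert-Schmidt adjoint N^dagger: <E_ij, N^dag Y> = <N E_ij, Y> *)
Definition ch_adj {n m} (N : 'M[C]_n -> 'M[C]_m) (Y : 'M[C]_m) : 'M[C]_n :=
  \matrix_(i, j) \tr (adj (N (delta_mx i j)) *m Y).

Definition petz {n m} (sigma : 'M[C]_n) (N : 'M[C]_n -> 'M[C]_m) (X : 'M[C]_m) : 'M[C]_n :=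
  mxsqrt sigma *m ch_adj N (mxinvsqrt (N sigma) *m X *m mxinvsqrt (N sigma))
    *m mxsqrt sigma.

Definition rot_petz {n m} (sigma : 'M[C]_n) (N : 'M[C]_n -> 'M[C]_m)
    (U : 'M[C]_m) (V : 'M[C]_n) (X : 'M[C]_m) : 'M[C]_n :=
  V *m petz sigma N (U *m X *m adj U) *m adj V.

Definition admissible_UV {n m} (sigma : 'M[C]_n) (N : 'M[C]_n -> 'M[C]_m)
    (U : 'M[C]_m) (V : 'M[C]_n) : Prop :=
  [/\ unitary U, U *m N sigma = N sigma *m U, unitary V & V *m sigma = sigma *m V].

Definition in_recovery_hull {n m} (sigma : 'M[C]_n) (N : 'M[C]_n -> 'M[C]_m)
    (Rm : 'M[C]_m -> 'M[C]_n) : Prop :=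
  exists (k : nat) (p : 'I_k -> R) (Us : 'I_k -> 'M[C]_m) (Vs : 'I_k -> 'M[C]_n),
    [/\ forall i, 0 <= p i, \sum_(i < k) p i = 1,
        forall i, admissible_UV sigma N (Us i) (Vs i) &
        forall X, Rm X = \sum_(i < k) (p i)%:C%C *: rot_petz sigma N (Us i) (Vs i) X].

End QInfo.

(* Main.v *)
(* Write N(X) = \sum_l K_l X K_l^*. For a state rho, a POVM M with weights w > 0,
   and z in the strip 0 <= Re z <= 1, let
     F(z) = tr (rho^(1 - z/2) (\sum_x w_x^(z/2) M_x) sigma^(z/2)
                 N^*(N(sigma)^(-z/2) N(rho)^(z/2))).
   Then F(0) = 1, 2 F'(0) = \sum_x tr(rho M_x) ln w_x - Delta, where Delta is the
   difference of relative entropies, Re F <= 1 on the line Re z = 0, and by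
   2 Re <X, Y> <= |X|^2 + |Y|^2
     2 Re F(1 + it) <= 1 + \sum_x w_x tr(M_x R_t(N(rho)))
   with R_t a Petz map rotated by sigma^(it/2) and N(sigma)^(-it/2). The maximum
   principle on the strip therefore bounds
     \sum_x tr(rho M_x) ln w_x - Delta + 1
   by the supremum over t of \sum_x w_x tr(M_x R_t(N(rho))). As F may be averaged
   over finitely many data (rho, M, w) before the maximum principle is applied,
   a minimax argument (the convex hull of the rotated Petz maps with independent
   phases is compact) yields one map R of the hull that satisfies all these
   inequalities at once. Optimising over w gives the bound on the measured
   relative entropy; the bound by the fidelity is attained by the measurement of
   Fuchs and Caves. *)
Require Import Defs.
From HB Require Import structures.
From mathcomp Require Import all_boot all_order all_algebra.
From mathcomp Require Import sesquilinear spectral.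
From mathcomp Require Import complex mxtens.
From mathcomp Require Import classical_sets boolp reals ereal.
From mathcomp Require Import topology normedtype sequences derive realfun exp trigo.
From mathcomp Require Import finmap lra ring.
Set Implicit Arguments.
Unset Strict Implicit.
Unset Printing Implicit Defensive.
Import Order.TTheory GRing.Theory Num.Theory numFieldNormedType.Exports.
Local Open Scope ring_scope.

(** A single datum only yields a time t that depends on the state and the measurement; this order of
    quantifiers is what the minimax argument repairs. Two features make it applicable. The weights w
    replace the logarithm of the probabilities of the recovered state by an expression linear in the
    recovery map, and a positive combination of data has one supremum over t common to all its
    members, which is exactly the dual form of the wanted inequalities. The rotated maps for real t
    need not form a closed set; freeing the phase of each eigenvector of sigma and N(sigma) gives a
    torus, whose unitaries still commute with these operators, so the hull is not left. No average
    over t is ever integrated. Since spectra are finite, F is a finite sum of exponentials c e^(l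
    z): its derivative at 0 is a sum of coefficients, and the maximum principle reduces to a
    discrete Laplacian. Singular operators require two kinds of powers: those in F vanish on
    kernels, while the rotations must be unitary and are 1 there. *)

Section ComplexParts.
Variable R : realType.
Local Notation C := (R[i]).
Local Notation Re := (@complex.Re R).
Local Notation Im := (@complex.Im R).
Implicit Types z w : C.

Lemma ReD z w : Re (z + w) = Re z + Re w. Proof. by case: z w => [? ?] []. Qed.
Lemma ReN z : Re (- z) = - Re z. Proof. by case: z. Qed.
Lemma ImD z w : Im (z + w) = Im z + Im w. Proof. by case: z w => [? ?] []. Qed.
Lemma Re_sum I (r : seq I) P (F : I -> C) :
  Re (\sum_(i <- r | P i) F i) = \sum_(i <- r | P i) Re (F i).
Proof. exact: (big_morph Re ReD (erefl _)). Qed.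
Lemma Im_sum I (r : seq I) P (F : I -> C) :
  Im (\sum_(i <- r | P i) F i) = \sum_(i <- r | P i) Im (F i).
Proof. exact: (big_morph Im ImD (erefl _)). Qed.
Lemma ReM z w : Re (z * w) = Re z * Re w - Im z * Im w.
Proof. by case: z w => [? ?] []. Qed.
Lemma ImM z w : Im (z * w) = Re z * Im w + Im z * Re w.
Proof. by case: z w => [? ?] []. Qed.
Lemma ReZ (r : R) z : Re (r%:C%C * z) = r * Re z.
Proof. by rewrite ReM /= mul0r subr0. Qed.
Lemma conjE z : z^* = (Re z -i* Im z)%C. Proof. by case: z. Qed.
Lemma Re_conj z : Re z^* = Re z. Proof. by case: z. Qed.
Lemma mul_conjE z : z * z^* = (Re z ^+ 2 + Im z ^+ 2)%:C%C.
Proof.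
case: z => a b; rewrite conjE /= /GRing.mul /= mulrN opprK.
by rewrite -!expr2 mulrN mulrC addNr.
Qed.
Lemma ge0_ReE z : 0 <= z -> z = (Re z)%:C%C.
Proof. by case: z => a b; rewrite lecE /= => /andP[/eqP -> _]. Qed.
Lemma ge0_Re z : 0 <= z -> 0 <= Re z.
Proof. by case: z => a b; rewrite lecE /= => /andP[]. Qed.
Lemma gt0_Re z : 0 < z -> 0 < Re z.
Proof. by case: z => a b; rewrite ltcE /= => /andP[]. Qed.
Lemma conj_real_complex (r : R) : (r%:C%C)^* = r%:C%C :> C.
Proof. by rewrite conjE /= oppr0. Qed.

End ComplexParts.

(** * Adjoints, real traces and the Hilbert-Schmidt norm *)

Section Frobenius.
Variable R : realType.
Local Notation C := (R[i]).
Local Notation Re := (@complex.Re R).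
Local Notation Im := (@complex.Im R).

Lemma adjE p q (X : 'M[C]_(p, q)) i j : adj X i j = (X j i)^*.
Proof. by rewrite !mxE. Qed.
Lemma adjK p q (X : 'M[C]_(p, q)) : adj (adj X) = X.
Proof. by apply/matrixP=> i j; rewrite !adjE conjCK. Qed.
Lemma adjM p q r (X : 'M[C]_(p, q)) (Y : 'M[C]_(q, r)) :
  adj (X *m Y) = adj Y *m adj X.
Proof. by rewrite /adj trmx_mul map_mxM. Qed.
Lemma adjD p q (X Y : 'M[C]_(p, q)) : adj (X + Y) = adj X + adj Y.
Proof. by rewrite /adj linearD map_mxD. Qed.
Lemma adjN p q (X : 'M[C]_(p, q)) : adj (- X) = - adj X.
Proof. by rewrite /adj linearN map_mxN. Qed.
Lemma adjB p q (X Y : 'M[C]_(p, q)) : adj (X - Y) = adj X - adj Y.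
Proof. by rewrite adjD adjN. Qed.
Lemma adjZ p q a (X : 'M[C]_(p, q)) : adj (a *: X) = a^* *: adj X.
Proof. by rewrite /adj linearZ map_mxZ. Qed.
Lemma adj0 p q : adj (0 : 'M[C]_(p, q)) = 0.
Proof. by rewrite /adj trmx0 map_mx0. Qed.
Lemma adj1 p : adj (1%:M : 'M[C]_p) = 1%:M.
Proof. by rewrite /adj trmx1 map_mx1. Qed.
Lemma adj_sum p q I (r : seq I) P (F : I -> 'M[C]_(p, q)) :
  adj (\sum_(i <- r | P i) F i) = \sum_(i <- r | P i) adj (F i).
Proof. exact: (big_morph (@adj R p q) (@adjD p q) (@adj0 p q)). Qed.
Lemma adj_diag p (d : 'rV[C]_p) : adj (diag_mx d) = diag_mx (map_mx Num.conj d).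
Proof. by rewrite /adj tr_diag_mx map_diag_mx. Qed.
Lemma tr_adj p (X : 'M[C]_p) : \tr (adj X) = (\tr X)^*.
Proof. by rewrite /adj trace_map_mx mxtrace_tr. Qed.

Definition rtr p (X : 'M[C]_p) : R := Re (\tr X).
(** The squared Hilbert-Schmidt norm. *)
Definition fro p q (X : 'M[C]_(p, q)) : R := rtr (X *m adj X).

Lemma rtrC p q (X : 'M[C]_(p, q)) (Y : 'M[C]_(q, p)) : rtr (X *m Y) = rtr (Y *m X).
Proof. by rewrite /rtr mxtrace_mulC. Qed.
Lemma rtrD p (X Y : 'M[C]_p) : rtr (X + Y) = rtr X + rtr Y.
Proof. by rewrite /rtr linearD ReD. Qed.
Lemma rtrN p (X : 'M[C]_p) : rtr (- X) = - rtr X.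
Proof. by rewrite /rtr linearN ReN. Qed.
Lemma rtrB p (X Y : 'M[C]_p) : rtr (X - Y) = rtr X - rtr Y.
Proof. by rewrite rtrD rtrN. Qed.
Lemma rtr_adj p (X : 'M[C]_p) : rtr (adj X) = rtr X.
Proof. by rewrite /rtr tr_adj Re_conj. Qed.
Lemma rtr_sum p I (r : seq I) P (F : I -> 'M[C]_p) :
  rtr (\sum_(i <- r | P i) F i) = \sum_(i <- r | P i) rtr (F i).
Proof. by apply: (big_morph (@rtr p) (@rtrD p)); rewrite /rtr mxtrace0. Qed.
Lemma rtrZ p (a : R) (X : 'M[C]_p) : rtr (a%:C%C *: X) = a * rtr X.
Proof. by rewrite /rtr mxtraceZ ReZ. Qed.

Lemma froE p q (X : 'M[C]_(p, q)) :
  fro X = \sum_i \sum_j (Re (X i j) ^+ 2 + Im (X i j) ^+ 2).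
Proof.
rewrite /fro /rtr /mxtrace Re_sum; apply: eq_bigr => i _.
rewrite mxE Re_sum; apply: eq_bigr => j _.
by rewrite adjE mul_conjE.
Qed.
Lemma fro_ge0 p q (X : 'M[C]_(p, q)) : 0 <= fro X.
Proof. by rewrite froE !sumr_ge0 // => i _; rewrite sumr_ge0 // => j _; rewrite addr_ge0 ?sqr_ge0. Qed.
Lemma fro_eq0 p q (X : 'M[C]_(p, q)) : fro X = 0 -> X = 0.
Proof.
rewrite froE => /eqP; rewrite psumr_eq0 => [/allP H|i _]; last first.
  by rewrite sumr_ge0 // => j _; rewrite addr_ge0 ?sqr_ge0.
apply/matrixP=> i j; rewrite mxE.
have := H i; rewrite mem_index_enum => /(_ isT) /=.
rewrite psumr_eq0 => [/allP /(_ j)|k _]; last by rewrite addr_ge0 ?sqr_ge0.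
rewrite mem_index_enum => /(_ isT) /=.
rewrite paddr_eq0 ?sqr_ge0 // !sqrf_eq0 => /andP[/eqP a /eqP b].
by case: (X i j) a b => ? ? /= -> ->.
Qed.
Lemma fro_adj p q (X : 'M[C]_(p, q)) : fro (adj X) = fro X.
Proof. by rewrite /fro adjK rtrC. Qed.

Lemma fro_gram p q (X : 'M[C]_(p, q)) : fro X = rtr (adj X *m X).
Proof. by rewrite rtrC. Qed.

(** Cauchy-Schwarz in additive form, from [fro (adj X - Y) >= 0]. This form can be summed over Kraus
    operators and outcomes without square roots. *)
Lemma rtr_mul_le p q (X : 'M[C]_(p, q)) (Y : 'M[C]_(q, p)) :
  rtr (X *m Y) *+ 2 <= fro X + fro Y.
Proof.
have := fro_ge0 (adj X - Y).
rewrite {1}/fro adjB adjK mulmxBl !mulmxBr !rtrB opprB.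
rewrite -(rtr_adj (adj X *m adj Y)) adjM !adjK.
rewrite (rtrC (adj X)) (rtrC Y X) -/(fro X) -/(fro Y) => h; lra.
Qed.

End Frobenius.

(** * Positive matrices and spectral functional calculus *)

Section FunctionalCalculus.
Variable R : realType.
Local Notation C := (R[i]).

Lemma psd_gram p q (X : 'M[C]_(p, q)) : psd (adj X *m X).
Proof.
split=> [|v]; first by rewrite adjM adjK.
rewrite mulmxA -adjM -mulmxA mxE sumr_ge0 // => i _.
by rewrite adjE mulrC mul_conjE ler0c addr_ge0 ?sqr_ge0.
Qed.
Lemma psd_gramC p q (X : 'M[C]_(p, q)) : psd (X *m adj X).
Proof. by have := psd_gram (adj X); rewrite adjK. Qed.
Lemma psdD p (A B : 'M[C]_p) : psd A -> psd B -> psd (A + B).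
Proof.
move=> [hA A0] [hB B0]; split=> [|v]; first by rewrite adjD hA hB.
by rewrite mulmxDr mulmxDl mxE addr_ge0.
Qed.
Lemma psd0 p : psd (0 : 'M[C]_p).
Proof. by split=> [|v]; rewrite ?adj0 // mulmx0 mul0mx mxE. Qed.
Lemma psdZ p (a : R) (A : 'M[C]_p) : 0 <= a -> psd A -> psd (a%:C%C *: A).
Proof.
move=> a0 [hA A0]; split=> [|v]; first by rewrite adjZ conj_real_complex hA.
by rewrite -scalemxAr -scalemxAl mxE mulr_ge0 // ler0c.
Qed.
Lemma psd_sum p I (r : seq I) (P : pred I) (F : I -> 'M[C]_p) :
  (forall i, P i -> psd (F i)) -> psd (\sum_(i <- r | P i) F i).
Proof. by move=> h; elim/big_ind: _ => //; [exact: psd0|exact: psdD]. Qed.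
Lemma psd_conj p q (X : 'M[C]_(q, p)) (A : 'M[C]_p) :
  psd A -> psd (X *m A *m adj X).
Proof.
move=> [hA A0]; split=> [|v]; first by rewrite !adjM adjK hA mulmxA.
by have := A0 (adj X *m v); rewrite adjM adjK !mulmxA.
Qed.

Section Spectral.
Variables (n : nat) (A : 'M[C]_n).
Implicit Types f g : C -> C.
Local Notation Q := (spectralmx A).
Local Notation d := (spectral_diag A).

Lemma spectralmxK : adj Q *m Q = 1%:M.
Proof.
have u := spectral_unitarymx A.
by rewrite -(mulVmx (unitarymx_unit u)) (invmx_unitary u).
Qed.
Lemma spectralmxKV : Q *m adj Q = 1%:M.
Proof. exact: mulmx1C spectralmxK. Qed.
Lemma mxfunE f : mxfun f A = adj Q *m diag_mx (map_mx f d) *m Q.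
Proof.
rewrite /mxfun; congr (_ *m _ *m _).
rewrite -[RHS]mulmx1 -(mulmxV (spectral_unit A)) mulmxA spectralmxK.
by rewrite mul1mx.
Qed.
Lemma mxfunM f g : mxfun f A *m mxfun g A = mxfun (fun z => f z * g z) A.
Proof.
rewrite !mxfunE !mulmxA -(mulmxA _ Q) spectralmxKV mulmx1; congr (_ *m _).
rewrite -mulmxA mulmx_diag; congr (_ *m diag_mx _).
by apply/rowP=> i; rewrite !mxE.
Qed.
Lemma adj_mxfun f : adj (mxfun f A) = mxfun (fun z => (f z)^*) A.
Proof.
rewrite !mxfunE !adjM adjK adj_diag mulmxA; congr (_ *m diag_mx _ *m _).
by apply/rowP=> i; rewrite !mxE.
Qed.
Lemma eq_mxfun f g : (forall i, f (d 0 i) = g (d 0 i)) -> mxfun f A = mxfun g A.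
Proof.
move=> e; rewrite !mxfunE; congr (_ *m diag_mx _ *m _).
by apply/rowP=> i; rewrite !mxE.
Qed.
Lemma mxfun_id : adj A = A -> mxfun id A = A.
Proof.
move=> h; rewrite /mxfun map_mx_id //; apply/esym/orthomx_spectralP.
by apply/normalmxP; rewrite -/(adj A) h.
Qed.
Lemma psd_mxfun f : (forall i, 0 <= f (d 0 i)) -> psd (mxfun f A).
Proof.
move=> f0; have -> : mxfun f A = mxfun (fun z => sqrtC (f z)) A *m adj (mxfun (fun z => sqrtC (f z)) A).
  rewrite adj_mxfun mxfunM; apply: eq_mxfun => i /=.
  have s0 : 0 <= sqrtC (f (d 0 i)) by rewrite sqrtC_ge0.
  have /CrealP -> : sqrtC (f (d 0 i)) \is Num.real by rewrite realE s0.
  by rewrite -expr2 sqrtCK.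
exact: psd_gramC.
Qed.
Lemma spectral_diagE : adj A = A -> diag_mx d = Q *m A *m adj Q.
Proof.
move=> h; transitivity (Q *m mxfun id A *m adj Q); last by rewrite mxfun_id.
rewrite mxfunE map_mx_id // !mulmxA spectralmxKV mul1mx.
by rewrite -mulmxA spectralmxKV mulmx1.
Qed.
Lemma spectral_diag_ge0 : psd A -> forall i, 0 <= d 0 i.
Proof.
move=> [h A0] i; have := A0 (adj Q *m delta_mx i 0).
rewrite adjM adjK !mulmxA.
rewrite -(mulmxA _ Q A) -(mulmxA _ (Q *m A)) -spectral_diagE //.
rewrite -mulmxA.
rewrite (_ : (_ *m _) 0 0 = d 0 i) // mxE (bigD1 i) //= adjE !mxE !eqxx conjC1 mul1r.
rewrite (bigD1 i) //= !mxE !eqxx mulr1 !big1 ?addr0 //.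
  by move=> j ji; rewrite adjE !mxE (negPf ji) /= conjC0 mul0r.
by move=> j ji; rewrite !mxE (negPf ji) /= mulr0.
Qed.

(** The functional calculus does not depend on the diagonalisation: the change of basis [Z]
    intertwines the two diagonals, so [Z i j] is nonzero only where the eigenvalues agree, and [Z]
    then intertwines their images under f as well. *)
Lemma mxfun_diag_unique f (W : 'M[C]_n) (e : 'rV[C]_n) :
  adj W *m W = 1%:M -> adj A = A -> A = adj W *m diag_mx e *m W ->
  mxfun f A = adj W *m diag_mx (map_mx f e) *m W.
Proof.
move=> WW h AE; have WW' := mulmx1C WW.
pose Z := W *m adj Q.
have ZE : diag_mx e *m Z = Z *m diag_mx d.
  have WA : W *m A = diag_mx e *m W by rewrite [X in _ *m X]AE !mulmxA WW' mul1mx.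
  by rewrite spectral_diagE // /Z !mulmxA -(mulmxA W) spectralmxK mulmx1 WA.
have ZfE : diag_mx (map_mx f e) *m Z = Z *m diag_mx (map_mx f d).
  apply/matrixP=> i j.
  have /matrixP /(_ i j) := ZE; rewrite !mul_diag_mx !mul_mx_diag !mxE.
  set x := (\sum_(_ < _) _) => ex.
  have [->|x0] := eqVneq x 0; first by rewrite mulr0 mul0r.
  have -> : e 0 i = d 0 j by apply: (mulIf x0); rewrite ex mulrC.
  by rewrite mulrC.
rewrite mxfunE -[X in X *m _ *m _ = _]mul1mx -WW.
rewrite -(mulmxA (adj W) W) -/Z -(mulmxA (adj W)) -ZfE /Z !mulmxA.
by rewrite -mulmxA spectralmxK mulmx1.
Qed.

End Spectral.

End FunctionalCalculus.

(** * Complex exponentials and scalar powers *)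

Section Exponentials.
Variable R : realType.
Local Notation C := (R[i]).
Local Notation Re := (@complex.Re R).
Local Notation Im := (@complex.Im R).

(** The number e^(l z) at z = th + i t, by its real and imaginary parts. *)
Definition cexp (l th t : R) : C :=
  (expR (l * th) * cos (l * t) +i* (expR (l * th) * sin (l * t)))%C.

Lemma cexpDl l l' th t : cexp (l + l') th t = cexp l th t * cexp l' th t.
Proof.
rewrite /cexp !mulrDl expRD cosD sinD.
by apply/eqP; rewrite eq_complex ReM ImM /=; apply/andP; split; apply/eqP; ring.
Qed.
Lemma cexpDr l th t th' t' : cexp l (th + th') (t + t') = cexp l th t * cexp l th' t'.
Proof.
rewrite /cexp !mulrDr expRD cosD sinD.
by apply/eqP; rewrite eq_complex ReM ImM /=; apply/andP; split; apply/eqP; ring.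
Qed.
Lemma cexp0 l : cexp l 0 0 = 1.
Proof. by rewrite /cexp !mulr0 expR0 cos0 sin0 mulr1 mulr0. Qed.
Lemma cexp0l th t : cexp 0 th t = 1.
Proof. by rewrite /cexp !mul0r expR0 cos0 sin0 mulr1 mulr0. Qed.
Lemma conj_cexp l th t : (cexp l th t)^* = cexp l th (- t).
Proof. by rewrite conjE /cexp /= mulrN cosN sinN mulrN. Qed.
Lemma cexp_real l th : cexp l th 0 = (expR (l * th))%:C%C.
Proof. by rewrite /cexp mulr0 cos0 sin0 mulr1 mulr0. Qed.

(* [hpowC th t a] is a^((th + i t)/2) for a > 0, and 0 at a = 0 for every exponent *)
Definition hpowC (th t : R) (a : C) : C :=
  if 0 < a then cexp (ln (Re a) / 2) th t else 0.
(** The value 1 off the positive numbers keeps the modulus equal to 1 everywhere, so that the matrix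
    function is unitary even for a singular matrix. *)
Definition phaseC (t : R) (a : C) : C :=
  if 0 < a then cexp (ln (Re a) / 2) 0 t else 1.

Lemma hpowCM th t th' t' a : hpowC th t a * hpowC th' t' a = hpowC (th + th') (t + t') a.
Proof. by rewrite /hpowC; case: ifP => _; rewrite ?mulr0 // cexpDr. Qed.
Lemma conj_hpowC th t a : (hpowC th t a)^* = hpowC th (- t) a.
Proof. by rewrite /hpowC; case: ifP => _; rewrite ?conjC0 // conj_cexp. Qed.
Lemma phaseCM th t a : phaseC t a * hpowC th 0 a = hpowC th t a.
Proof.
rewrite /phaseC /hpowC; case: ifP => _; last by rewrite mulr0.
by rewrite -cexpDr add0r addr0.
Qed.
Lemma norm_phaseC t a : Re (phaseC t a) ^+ 2 + Im (phaseC t a) ^+ 2 = 1.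
Proof.
rewrite /phaseC; case: ifP => _ /=; last by rewrite expr1n expr0n addr0.
by rewrite mulr0 expR0 !mul1r cos2Dsin2.
Qed.
Lemma hpowC0 a : hpowC 0 0 a = (0 < a)%R%:R.
Proof. by rewrite /hpowC; case: ifP => _; rewrite ?cexp0. Qed.
Lemma hpowC2 a : 0 <= a -> hpowC 2 0 a = a.
Proof.
rewrite /hpowC le_eqVlt => /orP[/eqP <-|a0]; first by rewrite ltxx.
rewrite a0 cexp_real -mulrA mulVf ?mulr1 ?pnatr_eq0 // lnK ?posrE ?gt0_Re //.
by rewrite -ge0_ReE // ltW.
Qed.
Lemma expR_half_ln (x : R) : 0 < x -> expR (ln x / 2) = Num.sqrt x.
Proof.
move=> x0; rewrite -[in RHS](lnK (x := x)) ?posrE // [in RHS](splitr (ln x)) expRD.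
by rewrite -expr2 sqrtr_sqr ger0_norm // expR_ge0.
Qed.
Lemma hpowC1 a : 0 <= a -> hpowC 1 0 a = sqrtC' a.
Proof.
move=> a0; rewrite /hpowC /sqrtC' a0; case: ifP => [a1|].
  by rewrite cexp_real mulr1 expR_half_ln // gt0_Re.
by move: a0; rewrite le_eqVlt => /orP[/eqP <-|->]; rewrite // sqrtr0.
Qed.
Lemma hpowCN1 a : hpowC (-1) 0 a = invsqrtC a.
Proof.
rewrite /hpowC /invsqrtC; case: ifP => // a0.
by rewrite cexp_real mulrN1 expRN expR_half_ln // gt0_Re.
Qed.

Lemma sqr_cexp1 (c t : R) : 0 < c ->
  Re (cexp (ln c / 2) 1 t) ^+ 2 + Im (cexp (ln c / 2) 1 t) ^+ 2 = c.
Proof.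
move=> c0; rewrite /cexp mulr1 /= !exprMn -mulrDr cos2Dsin2 mulr1.
by rewrite expr2 -expRD -splitr lnK.
Qed.

End Exponentials.

(* Sealed, so that rewriting with [mulmxA] does not look inside them. *)
HB.lock Definition hpow (R : realType) (th t : R) n (A : 'M[R[i]]_n) :=
  mxfun (hpowC th t) A.
HB.lock Definition phasemx (R : realType) (t : R) n (A : 'M[R[i]]_n) :=
  mxfun (phaseC t) A.
HB.lock Definition hlog (R : realType) n (A : 'M[R[i]]_n) := mxlog A.
(** For psd A the projection onto the support: exponent 0 gives 1 at positive eigenvalues and 0 at
    the others. *)
Definition suppmx (R : realType) n (A : 'M[R[i]]_n) := hpow 0 0 A.

(** * Complex powers of matrices and support projections *)

Section Powers.
Variable R : realType.
Local Notation C := (R[i]).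

Section PowersOf.
Variables (n : nat) (A : 'M[C]_n).

Lemma hpowM th t th' t' : hpow th t A *m hpow th' t' A = hpow (th + th') (t + t') A.
Proof. by rewrite !hpow.unlock mxfunM; apply: eq_mxfun => i; rewrite hpowCM. Qed.
Lemma adj_hpow th t : adj (hpow th t A) = hpow th (- t) A.
Proof. by rewrite !hpow.unlock adj_mxfun; apply: eq_mxfun => i; rewrite conj_hpowC. Qed.
Lemma phase_hpow th t : phasemx t A *m hpow th 0 A = hpow th t A.
Proof.
rewrite phasemx.unlock !hpow.unlock mxfunM; apply: eq_mxfun => i.
by rewrite phaseCM.
Qed.
Lemma hpow_phase th t : hpow th 0 A *m phasemx t A = hpow th t A.
Proof.
rewrite phasemx.unlock !hpow.unlock mxfunM; apply: eq_mxfun => i.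
by rewrite mulrC phaseCM.
Qed.
Lemma mxinvsqrtE : mxinvsqrt A = hpow (-1) 0 A.
Proof. by rewrite hpow.unlock; apply: eq_mxfun => i; rewrite hpowCN1. Qed.
Lemma suppmx_hpow th t : suppmx A *m hpow th t A = hpow th t A.
Proof. by rewrite hpowM !add0r. Qed.
Lemma hpow_suppmx th t : hpow th t A *m suppmx A = hpow th t A.
Proof. by rewrite hpowM !addr0. Qed.
Lemma adj_suppmx : adj (suppmx A) = suppmx A.
Proof. by rewrite adj_hpow oppr0. Qed.
Lemma suppmxK : suppmx A *m suppmx A = suppmx A.
Proof. by rewrite hpowM addr0. Qed.

Hypothesis A0 : psd A.
Lemma psd_adj : adj A = A. Proof. by case: A0. Qed.
Lemma hpow2 : hpow 2 0 A = A.
Proof.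
rewrite hpow.unlock -[RHS](mxfun_id psd_adj); apply: eq_mxfun => i.
by rewrite hpowC2 ?spectral_diag_ge0.
Qed.
Lemma mxsqrtE : mxsqrt A = hpow 1 0 A.
Proof.
by rewrite hpow.unlock; apply: eq_mxfun => i; rewrite hpowC1 ?spectral_diag_ge0.
Qed.
Lemma hpow1K : hpow 1 0 A *m hpow 1 0 A = A.
Proof. by rewrite hpowM addr0 hpow2. Qed.
Lemma adj_hpow0 th : adj (hpow th 0 A) = hpow th 0 A.
Proof. by rewrite adj_hpow oppr0. Qed.
Lemma psd_mxsqrt : psd (mxsqrt A).
Proof.
apply: psd_mxfun => i; rewrite /sqrtC' spectral_diag_ge0 // ler0c.
exact: sqrtr_ge0.
Qed.
Lemma suppmx_mul : suppmx A *m A = A.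
Proof. by rewrite -{2}hpow2 suppmx_hpow hpow2. Qed.
Lemma mul_suppmx : A *m suppmx A = A.
Proof. by rewrite -{1}hpow2 hpow_suppmx hpow2. Qed.
Lemma fro_mulsqrt p (X : 'M[C]_(p, n)) : fro (X *m hpow 1 0 A) = rtr (X *m A *m adj X).
Proof. by rewrite /fro adjM adj_hpow0 !mulmxA -(mulmxA X) hpow1K. Qed.
End PowersOf.

Lemma supp_le_mul n p (rho sigma : 'M[C]_n) (X : 'M[C]_(n, p)) :
  supp_le rho sigma -> sigma *m X = 0 -> rho *m X = 0.
Proof.
move=> h sX; apply/matrixP=> i j; rewrite [RHS]mxE.
have /h /matrixP /(_ i 0) : sigma *m col j X = 0 by rewrite colE mulmxA sX mul0mx.
by rewrite colE mulmxA -colE !mxE.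
Qed.
Lemma supp_le_suppmx n (rho sigma : 'M[C]_n) :
  psd sigma -> supp_le rho sigma -> rho *m suppmx sigma = rho.
Proof.
move=> s0 h; apply/esym/eqP; rewrite -subr_eq0 -[X in X - _]mulmx1 -mulmxBr; apply/eqP.
by apply: supp_le_mul h _; rewrite mulmxBr mulmx1 mul_suppmx // subrr.
Qed.

Lemma fro_proj p n (X : 'M[C]_(p, n)) (P : 'M[C]_n) :
  P *m adj P = P -> fro (X *m P) = rtr (X *m P *m adj X).
Proof. by move=> PP; rewrite /fro adjM mulmxA -(mulmxA X) PP. Qed.
Lemma suppmx_proj n (A : 'M[C]_n) : suppmx A *m adj (suppmx A) = suppmx A.
Proof. by rewrite adj_suppmx suppmxK. Qed.
Lemma suppmxC_proj n (A : 'M[C]_n) :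
  (1%:M - suppmx A) *m adj (1%:M - suppmx A) = 1%:M - suppmx A.
Proof.
by rewrite adjB adj1 adj_suppmx mulmxBl mul1mx mulmxBr mulmx1 suppmxK subrr subr0.
Qed.
Lemma fro_mulsupp p n (A : 'M[C]_n) (X : 'M[C]_(p, n)) : fro (X *m suppmx A) <= fro X.
Proof.
have -> : fro X = fro (X *m suppmx A) + fro (X *m (1%:M - suppmx A)).
  rewrite !fro_proj ?suppmx_proj ?suppmxC_proj // -rtrD -mulmxDl -mulmxDr.
  by rewrite addrC subrK mulmx1.
by rewrite lerDl fro_ge0.
Qed.
(** [hpow 0 t A] is a partial isometry with initial and final projection [suppmx A], hence a
    contraction. *)
Lemma fro_unit_hpow p n (A : 'M[C]_n) (X : 'M[C]_(p, n)) t :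
  fro (X *m hpow 0 t A) <= fro X.
Proof.
apply: le_trans (fro_mulsupp A X).
rewrite (fro_proj _ (suppmx_proj A)) /fro adjM adj_hpow mulmxA -(mulmxA X) hpowM.
by rewrite subrr addr0.
Qed.
Lemma fro_hpow_unit p n (A : 'M[C]_n) (X : 'M[C]_(n, p)) t :
  fro (hpow 0 t A *m X) <= fro X.
Proof. by rewrite -fro_adj adjM adj_hpow (le_trans (fro_unit_hpow _ _ _)) ?fro_adj. Qed.

Lemma fro_hpow1 n (A : 'M[C]_n) t : psd A -> fro (hpow 1 t A) = rtr A.
Proof. by move=> A0; rewrite /fro adj_hpow hpowM subrr hpow2. Qed.

End Powers.

Lemma tr_delta_mul (R : pzSemiRingType) p q (Z : 'M[R]_(q, p)) i j :
  \tr (delta_mx i j *m Z) = Z j i.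
Proof.
rewrite /mxtrace (bigD1 i) //= big1 ?addr0 => [|a ai].
  rewrite mxE (bigD1 j) //= big1 ?addr0 => [|b bj]; first by rewrite !mxE !eqxx mul1r.
  by rewrite !mxE (negPf bj) andbF mul0r.
by rewrite mxE big1 // => b _; rewrite mxE (negPf ai) mul0r.
Qed.

(** * Kraus operators, the adjoint channel and supports *)

Section Kraus.
Variable R : realType.
Local Notation C := (R[i]).
Variables n m : nat.
Implicit Type N : 'M[C]_n -> 'M[C]_m.

Lemma linear_map0 N : linear_map N -> N 0 = 0.
Proof.
move=> lN; have := lN 1 0 0; rewrite !scale1r addr0 => /eqP.
by rewrite -subr_eq subrr eq_sym => /eqP.
Qed.
Lemma linear_mapD N X Y : linear_map N -> N (X + Y) = N X + N Y.
Proof. by move=> lN; have := lN 1 X Y; rewrite !scale1r. Qed.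
Lemma linear_mapZ N a X : linear_map N -> N (a *: X) = a *: N X.
Proof. by move=> lN; have := lN a X 0; rewrite linear_map0 // !addr0. Qed.
Lemma linear_map_sum N I (r : seq I) (P : pred I) (F : I -> 'M[C]_n) :
  linear_map N -> N (\sum_(i <- r | P i) F i) = \sum_(i <- r | P i) N (F i).
Proof.
move=> lN; apply: (big_morph N) => [X Y|]; [exact: linear_mapD|exact: linear_map0].
Qed.

(** Choi's construction: [w] is the unnormalised maximally entangled vector, [Ch] the Choi matrix,
    and the Kraus operators are the columns of its square root reshaped to matrices. *)
Lemma kraus_decomposition N : tpcp N ->
  exists k (K : 'I_k -> 'M[C]_(m, n)), forall X, N X = \sum_l K l *m X *m adj (K l).
Proof.
case=> lN _ cpN.
pose w : 'cV[C]_(n * n) :=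
  \col_p ((mxtens_unindex p).1 == (mxtens_unindex p).2)%:R.
have := cpN n _ (psd_gramC w); set Ch := ampliate _ _ => Ch0.
have ChE i a j b : Ch (mxtens_index (i, a)) (mxtens_index (j, b)) = N (delta_mx i j) a b.
  rewrite /Ch /ampliate mxE !mxtens_indexK; congr (N _ a b).
  apply/matrixP=> c d; rewrite !mxE big_ord1 adjE !mxE !mxtens_indexK /=.
  by rewrite rmorph_nat -natrM mulnb (eq_sym i) (eq_sym j).
pose S := hpow 1 0 Ch.
have SE : Ch = S *m adj S by rewrite adj_hpow0 hpow1K.
exists (n * m)%N, (fun l => \matrix_(a, i) S (mxtens_index (i, a)) l) => X.
rewrite {1}(matrix_sum_delta X) linear_map_sum //.
apply/matrixP=> a b; rewrite !summxE.
transitivity (\sum_i \sum_j \sum_l X i j * (S (mxtens_index (i, a)) l * (S (mxtens_index (j, b)) l)^*)).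
  apply: eq_bigr => i _; rewrite linear_map_sum // summxE; apply: eq_bigr => j _.
  rewrite linear_mapZ // mxE -ChE SE mxE mulr_sumr; apply: eq_bigr => l _.
  by rewrite adjE.
under eq_bigr do rewrite exchange_big /=.
rewrite exchange_big /=; apply: eq_bigr => l _.
rewrite exchange_big /= mxE; apply: eq_bigr => j _.
rewrite mxE mulr_suml adjE mxE; apply: eq_bigr => i _.
by rewrite mxE; ring.
Qed.

Section Channel.
Variables (N : 'M[C]_n -> 'M[C]_m) (k : nat) (K : 'I_k -> 'M[C]_(m, n)).
Hypothesis NE : forall X, N X = \sum_l K l *m X *m adj (K l).
Hypothesis trN : forall X, \tr (N X) = \tr X.

Lemma ch_adjE Y : ch_adj N Y = \sum_l adj (K l) *m Y *m K l.
Proof.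
apply/matrixP=> i j; rewrite mxE NE adj_sum mulmx_suml linear_sum /= summxE.
apply: eq_bigr => l _; rewrite !adjM adjK mxtrace_mulC !mulmxA mxtrace_mulC.
rewrite !mulmxA mxtrace_mulC.
rewrite (_ : adj (delta_mx i j) = delta_mx j i :> 'M[C]_n); last first.
  by apply/matrixP=> a b; rewrite adjE !mxE rmorph_nat andbC.
by rewrite !mulmxA -(mulmxA (delta_mx _ _)) -(mulmxA (delta_mx _ _)) tr_delta_mul.
Qed.
Lemma kraus_unital : \sum_l adj (K l) *m K l = 1%:M.
Proof.
apply/matrixP=> i j.
have := trN (delta_mx j i); rewrite NE linear_sum /=.
under eq_bigr do rewrite -mulmxA mxtrace_mulC -mulmxA.
rewrite -linear_sum -mulmx_sumr /= tr_delta_mul => ->.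
by rewrite -[delta_mx j i]mulmx1 tr_delta_mul.
Qed.
Lemma ch_adj_dual X Y : \tr (X *m ch_adj N Y) = \tr (N X *m Y).
Proof.
rewrite ch_adjE NE mulmx_sumr mulmx_suml !linear_sum /=; apply: eq_bigr => l _.
by rewrite !mulmxA mxtrace_mulC !mulmxA.
Qed.
Lemma psd_channel X : psd X -> psd (N X).
Proof. by move=> X0; rewrite NE; apply: psd_sum => l _; apply: psd_conj. Qed.
Lemma psd_ch_adj Y : psd Y -> psd (ch_adj N Y).
Proof.
move=> Y0; rewrite ch_adjE; apply: psd_sum => l _.
by have := psd_conj (adj (K l)) Y0; rewrite adjK.
Qed.
Lemma sum_fro_kraus p (X : 'M[C]_(n, p)) : \sum_l fro (K l *m X) = fro X.
Proof.
rewrite [RHS]fro_gram -[X in rtr (_ *m X)]mul1mx -kraus_unital.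
rewrite mulmx_suml mulmx_sumr rtr_sum; apply: eq_bigr => l _.
by rewrite fro_gram adjM !mulmxA.
Qed.
(** For the complementary projection P, the squared norms of P K_l rho^(1/2) add up to the trace of
    P N(rho) P, which is 0. *)
Lemma channel_ker rho l : psd rho ->
  suppmx (N rho) *m K l *m rho = K l *m rho.
Proof.
move=> rho0; apply/esym/eqP; rewrite -subr_eq0 -{1}(mul1mx (K l)) -!mulmxBl.
set P := 1%:M - _.
suff /fro_eq0 PK : fro (P *m K l *m hpow 1 0 rho) = 0.
  by rewrite -[X in _ *m X](hpow1K rho0) mulmxA PK mul0mx.
have: \sum_l fro (P *m K l *m hpow 1 0 rho) = 0.
  transitivity (rtr (P *m N rho *m adj P)).
    rewrite NE mulmx_sumr mulmx_suml rtr_sum; apply: eq_bigr => i _.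
    by rewrite fro_mulsqrt // adjM !mulmxA.
  rewrite (_ : P *m N rho = 0) ?mul0mx /rtr ?mxtrace0 //.
  by rewrite /P mulmxBl mul1mx (suppmx_mul (psd_channel rho0)) subrr.
move=> /eqP; rewrite psumr_eq0 => [/allP /(_ l)|i _]; last exact: fro_ge0.
by rewrite mem_index_enum => /(_ isT) /eqP.
Qed.
(** Gives F(0) = 1, and removes the last factor of F from the terms of F'(0) that differentiate
    another one. *)
Lemma ch_adj_supp_mul rho : psd rho -> ch_adj N (suppmx (N rho)) *m rho = rho.
Proof.
move=> rho0; rewrite ch_adjE mulmx_suml -[RHS]mul1mx -kraus_unital mulmx_suml.
by apply: eq_bigr => l _; rewrite -!mulmxA (mulmxA (suppmx _)) channel_ker.
Qed.
(** A vector v killed by N(sigma) satisfies sigma^(1/2) K_l^* v = 0 for every l, because the squared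
    norms add up to <v, N(sigma) v>. *)
Lemma supp_le_channel rho sigma : psd rho -> psd sigma ->
  supp_le rho sigma -> supp_le (N rho) (N sigma).
Proof.
move=> rho0 sigma0 h v Nv.
have sKv l : hpow 1 0 sigma *m (adj (K l) *m v) = 0.
  have: \sum_l fro (adj v *m K l *m hpow 1 0 sigma) = 0.
    transitivity (rtr (adj v *m N sigma *m v)).
      rewrite NE mulmx_sumr mulmx_suml rtr_sum; apply: eq_bigr => i _.
      by rewrite fro_mulsqrt // adjM adjK !mulmxA.
    by rewrite -mulmxA Nv mulmx0 /rtr mxtrace0.
  move=> /eqP; rewrite psumr_eq0 => [/allP /(_ l)|i _]; last exact: fro_ge0.
  rewrite mem_index_enum => /(_ isT) /eqP /fro_eq0 /(congr1 (@adj _ _ _)).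
  by rewrite !adjM adj_hpow0 adjK adj0.
rewrite NE mulmx_suml big1 // => l _; rewrite -!mulmxA.
rewrite (supp_le_mul h) ?mulmx0 //.
by rewrite -(hpow1K sigma0) -mulmxA sKv mulmx0.
Qed.
End Channel.
End Kraus.

(** * Finite exponential sums with value and derivative at 0 *)

Section ExponentialSums.
Variable R : realType.
Local Notation C := (R[i]).
Implicit Types (F G : R -> R -> C) (s : seq (C * R)).

(** Entries of complex matrix powers have this form. The class is closed under sums and products,
    with the product rule on the coefficients, so no complex differentiation is required. *)
Definition esum s (th t : R) : C := \sum_(x <- s) x.1 * cexp x.2 th t.

(* [a] and [b] are the value and the derivative at 0 of the function
   [th + i t |-> F th t]. *)
Definition expsum F a b := exists s,
  [/\ forall th t, F th t = esum s th t, a = \sum_(x <- s) x.1 &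
      b = \sum_(x <- s) x.1 * (x.2)%:C%C].

Lemma expsum_cst c : expsum (fun _ _ => c) c 0.
Proof.
exists [:: (c, 0)]; split=> [th t||]; rewrite ?/esum big_seq1 //=.
  by rewrite cexp0l mulr1.
by rewrite mulr0.
Qed.
Lemma expsum_cexp l : expsum (cexp l) 1 l%:C%C.
Proof.
by exists [:: (1, l)]; split=> [th t||]; rewrite ?/esum big_seq1 //= mul1r.
Qed.
Lemma expsumD F G a b a' b' : expsum F a b -> expsum G a' b' ->
  expsum (fun th t => F th t + G th t) (a + a') (b + b').
Proof.
move=> [s [Fs -> ->]] [s' [Gs -> ->]]; exists (s ++ s').
by split=> [th t||]; rewrite ?Fs ?Gs /esum big_cat.
Qed.
Lemma expsumM F G a b a' b' : expsum F a b -> expsum G a' b' ->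
  expsum (fun th t => F th t * G th t) (a * a') (b * a' + a * b').
Proof.
move=> [s [Fs -> ->]] [s' [Gs -> ->]].
exists [seq (x.1 * y.1, x.2 + y.2) | x <- s, y <- s'].
split=> [th t||]; rewrite ?Fs ?Gs /esum big_allpairs_dep.
- rewrite mulr_suml; apply: eq_bigr => x _.
  by rewrite mulr_sumr; apply: eq_bigr => y _; rewrite /= cexpDl; ring.
- rewrite mulr_suml; apply: eq_bigr => x _.
  by rewrite mulr_sumr; apply: eq_bigr.
- rewrite !mulr_suml -big_split /=; apply: eq_bigr => x _.
  rewrite !mulr_sumr -big_split /=; apply: eq_bigr => y _.
  by rewrite rmorphD; ring.
Qed.
Lemma eq_expsum F G a b : (forall th t, F th t = G th t) ->
  expsum G a b -> expsum F a b.
Proof. by move=> e [s [Gs -> ->]]; exists s; split=> // th t; rewrite e. Qed.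
Lemma expsum_sum I (r : seq I) (F : I -> R -> R -> C) a b :
  (forall i, expsum (F i) (a i) (b i)) ->
  expsum (fun th t => \sum_(i <- r) F i th t) (\sum_(i <- r) a i) (\sum_(i <- r) b i).
Proof.
move=> h; elim: r => [|i r ih].
  rewrite !big_nil; apply: eq_expsum (expsum_cst 0) => th t.
  by rewrite big_nil.
rewrite !big_cons; apply: eq_expsum (expsumD (h i) ih) => th t.
by rewrite big_cons.
Qed.
Lemma expsum_scale F a b (e : R) : expsum F a b ->
  expsum (fun th t => F (e * th) (e * t)) a (e%:C%C * b).
Proof.
move=> [s [Fs -> ->]]; exists [seq (x.1, e * x.2) | x <- s].
split=> [th t||]; rewrite ?Fs /esum big_map //=.
  by apply: eq_bigr => x _; rewrite /cexp !(mulrCA _ e) !mulrA.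
by rewrite mulr_sumr; apply: eq_bigr => x _; rewrite rmorphM mulrCA.
Qed.

Definition mexpsum p q (F : R -> R -> 'M[C]_(p, q)) (A B : 'M[C]_(p, q)) :=
  forall i j, expsum (fun th t => F th t i j) (A i j) (B i j).

Lemma mexpsum_cst p q (A : 'M[C]_(p, q)) : mexpsum (fun _ _ => A) A 0.
Proof. by move=> i j; rewrite mxE; exact: expsum_cst. Qed.
Lemma mexpsumM p q r (F : R -> R -> 'M[C]_(p, q)) (G : R -> R -> 'M[C]_(q, r)) A B A' B' :
  mexpsum F A B -> mexpsum G A' B' ->
  mexpsum (fun th t => F th t *m G th t) (A *m A') (B *m A' + A *m B').
Proof.
move=> FAB GAB i j; rewrite !mxE -big_split /=.
apply: eq_expsum (expsum_sum _ (fun l => expsumM (FAB i l) (GAB l j))) => th t.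
by rewrite mxE.
Qed.
Lemma mexpsum_sum p q I (r : seq I) (F : I -> R -> R -> 'M[C]_(p, q)) A B :
  (forall i, mexpsum (F i) (A i) (B i)) ->
  mexpsum (fun th t => \sum_(i <- r) F i th t) (\sum_(i <- r) A i) (\sum_(i <- r) B i).
Proof.
move=> h i j; rewrite !summxE.
apply: eq_expsum (expsum_sum r (fun l => h l i j)) => th t.
by rewrite summxE.
Qed.
Lemma mexpsumZ p q (f : R -> R -> C) a b (A : 'M[C]_(p, q)) :
  expsum f a b -> mexpsum (fun th t => f th t *: A) (a *: A) (b *: A).
Proof.
move=> fab i j; rewrite !mxE; have := expsumM fab (expsum_cst (A i j)).
by rewrite mulr0 addr0; apply: eq_expsum => th t; rewrite mxE.
Qed.
Lemma expsum_tr p (F : R -> R -> 'M[C]_p) A B :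
  mexpsum F A B -> expsum (fun th t => \tr (F th t)) (\tr A) (\tr B).
Proof. by move=> h; apply: expsum_sum => i. Qed.
Lemma eq_mexpsum p q (F G : R -> R -> 'M[C]_(p, q)) A B :
  (forall th t, F th t = G th t) -> mexpsum G A B -> mexpsum F A B.
Proof. by move=> e h i j; apply: eq_expsum (h i j) => th t; rewrite e. Qed.
Lemma mexpsum_mxfun n (A : 'M[C]_n) (f : R -> R -> C -> C) (g h : C -> C) :
  (forall x, expsum (fun th t => f th t x) (g x) (h x)) ->
  mexpsum (fun th t => mxfun (f th t) A) (mxfun g A) (mxfun h A).
Proof.
move=> fgh; set d := spectral_diag A.
have D : mexpsum (fun th t => diag_mx (map_mx (f th t) d))
    (diag_mx (map_mx g d)) (diag_mx (map_mx h d)).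
  move=> i j; rewrite !mxE; have [ij|ij] := eqVneq i j.
    rewrite !mulr1n; apply: eq_expsum (fgh _) => th t.
    by rewrite !mxE ij eqxx mulr1n.
  rewrite !mulr0n; apply: eq_expsum (expsum_cst 0) => th t.
  by rewrite !mxE (negPf ij) mulr0n.
have := mexpsumM (mexpsumM (mexpsum_cst (adj (spectralmx A))) D)
  (mexpsum_cst (spectralmx A)).
rewrite mul0mx mulmx0 add0r addr0 -!mxfunE.
by apply: eq_mexpsum => th t; rewrite mxfunE.
Qed.
Lemma mexpsum_hpow n (A : 'M[C]_n) (e : R) :
  mexpsum (fun th t => hpow (e * th) (e * t) A) (suppmx A) ((e / 2)%:C%C *: hlog A).
Proof.
rewrite /suppmx hpow.unlock hlog.unlock.
have -> : (e / 2)%:C%C *: mxlog A = mxfun (fun x => (e / 2)%:C%C * logC x) A.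
  rewrite /mxlog !mxfunE scalemxAl scalemxAr; congr (_ *m _ *m _).
  by apply/matrixP=> i j; rewrite !mxE mulrnAr.
apply: mexpsum_mxfun => x; rewrite hpowC0 /hpowC /logC.
case: ifP => _; last by rewrite mulr0; exact: expsum_cst.
rewrite (_ : _ * _ = e%:C%C * (ln (complex.Re x) / 2)%:C%C).
  exact/expsum_scale/expsum_cexp.
by rewrite -!rmorphM mulrAC mulrA.
Qed.
End ExponentialSums.

(** * The maximum principle on the strip *)

Section ThreeLines.
Variable R : realType.
Local Notation C := (R[i]).
Local Notation Re := (@complex.Re R).
Local Notation Im := (@complex.Im R).
Local Open Scope classical_set_scope.
Implicit Types s : seq (C * R).

Lemma is_derive0_bound (f : R -> R) (l : R) :
  is_derive (0 : R) (1 : R) f l -> f 0 = 0 ->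
  forall e, 0 < e -> exists2 d, 0 < d & forall y, `|y| < d -> `|f y - l * y| <= e * `|y|.
Proof.
move=> df f0 e e0.
have cf : (fun h => h^-1 *: (f (h *: 1 + 0) - f 0)) @ 0^' --> l.
  by rewrite -(derive_val (is_derive := df)); exact: ex_derive.
move/cvgrPdist_lt : cf => /(_ e e0) [d /= d0 hd].
exists d => // y yd; have [->|y0] := eqVneq y 0.
  by rewrite f0 mulr0 subrr normr0 mulr0.
have := hd y; rewrite /= sub0r normrN => /(_ yd y0).
rewrite addr0 f0 subr0 (_ : y *: 1 = y) ?[_ *: _]mulr1 //.
rewrite [_ *: _](_ : _ = y^-1 * f y) // => h.
have -> : f y - l * y = - (l - y^-1 * f y) * y.
  by rewrite opprB mulrBl mulrAC mulVf // mul1r.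
by rewrite normrM normrN ler_wpM2r // ltW.
Qed.

(** An increment of M falls by at most K per step, so each of the first n increments is at least the
    initial one minus K n. *)
Lemma discrete_convex (M : nat -> R) (K : R) n : 0 <= K ->
  (forall j, (j.+1 < n)%N -> M j.+1 *+ 2 <= M j + M j.+2 + K) ->
  (M 1%N - M 0%N) *+ n <= M n - M 0%N + K * n%:R ^+ 2.
Proof.
move=> K0 hM; pose d j := M j.+1 - M j.
have hd j : (j < n)%N -> d 0%N <= d j + K * j%:R.
  elim: j => [|j ih] jn; first by rewrite mulr0 addr0.
  have := hM _ jn; have := ih (ltnW jn); rewrite /d -natr1 mulrDr mulr1; lra.
suff H j : (j <= n)%N -> d 0%N *+ j <= M j - M 0%N + K * j%:R ^+ 2 by exact: H.
elim: j => [|j ih] jn; first by rewrite mulr0n subrr add0r expr0n mulr0.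
have := ih (ltnW jn); have := hd _ jn; rewrite mulrSr -natr1.
have -> : K * (j%:R + 1) ^+ 2 = K * j%:R ^+ 2 + K * j%:R *+ 2 + K by ring.
have j0 : 0 <= K * j%:R by rewrite mulr_ge0.
rewrite /d; lra.
Qed.

(** Bounds |Re (c e^(l z))| on the strip 0 <= Re z <= 1. *)
Definition weight (x : C * R) : R := (`|Re x.1| + `|Im x.1|) * expR `|x.2|.
(** The five point Laplacian of step h multiplies e^(l z) by [defect (l * h)]. The quadratic terms
    of the exponentials and of the cosine cancel by harmonicity; what remains is of order x^4. *)
Definition defect (x : R) : R := expR x + expR (- x) + cos x *+ 2 - 4.

Lemma Re_mul_cexp_le (c : C) l th t : 0 <= th <= 1 ->
  `|Re (c * cexp l th t)| <= (`|Re c| + `|Im c|) * expR `|l|.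
Proof.
move=> /andP[th0 th1]; rewrite ReM /cexp /=.
have le1 : expR (l * th) <= expR `|l|.
  rewrite ler_expR (le_trans (ler_norm _)) // normrM (ger0_norm th0).
  by rewrite ler_piMr.
apply: le_trans (ler_normB _ _) _; rewrite mulrDl; apply: lerD.
  rewrite normrM ler_wpM2l // normrM ger0_norm ?expR_ge0 //.
  by apply: le_trans le1; rewrite ler_piMr ?expR_ge0 // cos_max.
rewrite normrM ler_wpM2l // normrM ger0_norm ?expR_ge0 //.
by apply: le_trans le1; rewrite ler_piMr ?expR_ge0 // sin_max.
Qed.

Lemma five_point s (h th t : R) : 0 <= th <= 1 ->
  Re (esum s th t) *+ 4 <=
  Re (esum s (th + h) t) + Re (esum s (th - h) t) +
  Re (esum s th (t + h)) + Re (esum s th (t - h)) +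
  \sum_(x <- s) weight x * `|defect (x.2 * h)|.
Proof.
move=> th01; rewrite -subr_ge0 /esum !Re_sum -sumrMnl.
rewrite -!big_split -sumrB /=; apply: sumr_ge0 => -[c l] _ /=.
have E : Re (c * cexp l (th + h) t) + Re (c * cexp l (th - h) t) +
  Re (c * cexp l th (t + h)) + Re (c * cexp l th (t - h)) - Re (c * cexp l th t) *+ 4
  = Re (c * cexp l th t) * defect (l * h).
  rewrite /defect !ReM /cexp /= !mulrDr !mulrN !expRD !cosD !sinD cosN sinN.
  ring.
have := Re_mul_cexp_le c l t th01; move: E; rewrite /weight /=.
set a := Re (c * cexp l th t); set W := (_ + _) * expR _ => E aW.
have : `|a * defect (l * h)| <= W * `|defect (l * h)| by rewrite normrM ler_wpM2r.
by rewrite ler_norml => /andP[]; lra.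
Qed.

Lemma defect_small (e : R) : 0 < e ->
  exists2 d, 0 < d & forall x, `|x| < d -> `|defect x| <= e * x ^+ 2.
Proof.
(* The factorisation [defect (y + y) = p y * q y] holds with p = 2 (sinh - sin) and q = 2 (sinh +
   sin). Here p' vanishes at 0 and q' is 4 there, so |q y| <= 5 |y| for small y; this is the 5 in
   [e / 5]. *)
move=> e0; pose p (y : R) := expR y - expR (- y) - sin y *+ 2.
pose q (y : R) := expR y - expR (- y) + sin y *+ 2.
have dp : is_derive (0 : R) (1 : R) p 0.
  by apply: is_derive_eq; rewrite oppr0 expR0 cos0; lra.
have dq : is_derive (0 : R) (1 : R) q 4.
  by apply: is_derive_eq; rewrite oppr0 expR0 cos0; lra.
have p0 : p 0 = 0 by rewrite /p oppr0 sin0 subrr mul0rn subrr.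
have q0 : q 0 = 0 by rewrite /q oppr0 sin0 subrr mul0rn addr0.
have e5 : 0 < e / 5 by rewrite divr_gt0.
have [d1 d10 hp] := is_derive0_bound dp p0 e5.
have [d2 d20 hq] := is_derive0_bound dq q0 ltr01.
exists (Num.min d1 d2); first by rewrite lt_min d10.
move=> x; rewrite lt_min => /andP[x1 x2].
have [y xy] : exists y, x = y + y by exists (x / 2); rewrite -splitr.
have xyN : `|x| = `|y| *+ 2 by rewrite xy -mulr2n normrMn.
have y1 : `|y| < d1 by apply: le_lt_trans x1; rewrite xyN mulr2n lerDl.
have y2 : `|y| < d2 by apply: le_lt_trans x2; rewrite xyN mulr2n lerDl.
have -> : defect x = p y * q y.
  have ee : expR y * expR (- y) = 1 by rewrite -expRD subrr expR0.
  have cs := cos2Dsin2 y.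
  rewrite /defect xy opprD !expRD cosD /p /q.
  have -> : cos y * cos y = 1 - sin y ^+ 2 by rewrite -cs addrK expr2.
  by transitivity (expR y * expR y + expR (- y) * expR (- y) - (expR y * expR (- y)) *+ 2 - 4 * sin y ^+ 2);
    [rewrite ee; ring | ring].
have {}hp : `|p y| <= e / 5 * `|y| by have := hp y y1; rewrite mul0r subr0.
have {}hq : `|q y| <= 5 * `|y|.
  have := hq y y2; have := ler_normB (q y) (4 * y); have := ler_normD (q y - 4 * y) (4 * y).
  rewrite subrK normrM (ger0_norm (_ : 0 <= 4)) //; lra.
rewrite normrM; apply: le_trans (ler_pM _ _ hp hq) _ => //.
rewrite (_ : e / 5 * `|y| * (5 * `|y|) = e * `|y| ^+ 2); last by field.
rewrite real_normK ?num_real //; apply: (ler_wpM2l (ltW e0)); rewrite xy.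
have -> : (y + y) ^+ 2 = 4 * y ^+ 2 by ring.
by have := sqr_ge0 y; lra.
Qed.

Lemma small_sum (T : Type) (s : seq T) (f : T -> R -> R) (g : R -> R) :
  (forall h, 0 <= g h) ->
  (forall x e, 0 < e -> exists2 d, 0 < d & forall h, `|h| < d -> f x h <= e * g h) ->
  forall e, 0 < e ->
  exists2 d, 0 < d & forall h, `|h| < d -> \sum_(x <- s) f x h <= e * g h.
Proof.
move=> g0 fg; elim: s => [|x s ih] e e0.
  by exists 1 => // h _; rewrite big_nil mulr_ge0 // ltW.
have e2 : 0 < e / 2 by rewrite divr_gt0.
have [d1 d10 h1] := ih _ e2; have [d2 d20 h2] := fg x _ e2.
exists (Num.min d1 d2) => [|h]; first by rewrite lt_min d10.
rewrite lt_min big_cons => /andP[/h1 a /h2 b]; lra.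
Qed.

Lemma defect_sum_small s (e : R) : 0 < e ->
  exists2 d, 0 < d &
    forall h, `|h| < d -> \sum_(x <- s) weight x * `|defect (x.2 * h)| <= e * h ^+ 2.
Proof.
move: e; apply: small_sum => [h|x e e0]; first exact: sqr_ge0.
have wx0 : 0 <= weight x by rewrite mulr_ge0 ?expR_ge0 ?addr_ge0.
have x20 := sqr_ge0 x.2.
have [w w0 wE] : exists2 w, 0 < w & w = (weight x + 1) * (x.2 ^+ 2 + 1).
  by exists ((weight x + 1) * (x.2 ^+ 2 + 1)) => //; rewrite mulr_gt0 // ltr_wpDl.
have [d d0 hd] := defect_small (divr_gt0 e0 w0).
have l0 : 0 < `|x.2| + 1 by rewrite ltr_wpDl.
exists (d / (`|x.2| + 1)) => [|h]; first exact: divr_gt0.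
rewrite ltr_pdivlMr // => hh.
have /hd H : `|x.2 * h| < d.
  by apply: le_lt_trans hh; rewrite normrM mulrC ler_wpM2l // lerDl.
apply: le_trans (ler_wpM2l wx0 H) _.
rewrite exprMn (_ : weight x * _ = e * h ^+ 2 * (weight x * x.2 ^+ 2 / w)); last by ring.
have := mulr_ge0 wx0 x20 => wx; apply: ler_piMr.
  by rewrite mulr_ge0 ?sqr_ge0 // ltW.
rewrite ler_pdivrMr // mul1r (_ : w = weight x * x.2 ^+ 2 + (weight x + x.2 ^+ 2 + 1)).
  by lra.
by rewrite wE; ring.
Qed.

Lemma esum_derive s (e : R) : 0 < e ->
  exists2 d, 0 < d & forall h, `|h| < d ->
  Re (\sum_(x <- s) x.1) + Re (\sum_(x <- s) x.1 * (x.2)%:C%C) * h - e * `|h|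
    <= Re (esum s h 0).
Proof.
move=> e0.
pose f (x : C * R) h := Re x.1 * (1 + x.2 * h - expR (x.2 * h)).
have [d d0 hd] : exists2 d, 0 < d & forall h, `|h| < d -> \sum_(x <- s) f x h <= e * `|h|.
  move: e e0; apply: small_sum => // -[c l] e e0; rewrite /f /=.
  have c0 : 0 < `|Re c| + 1 by rewrite ltr_wpDl.
  have df : is_derive (0 : R) (1 : R) (fun h => expR (h * l) - 1) l.
    by apply: is_derive_eq; rewrite mul0r expR0 scaler0 add0r subr0 mul1r [_%:A]mulr1.
  have f0 : expR (0 * l) - 1 = 0 :> R by rewrite mul0r expR0 subrr.
  have [d d0 hd] := is_derive0_bound df f0 (divr_gt0 e0 c0).
  exists d => // h /hd; rewrite (mulrC h) => H.
  apply: le_trans (ler_norm _) _; rewrite normrM.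
  rewrite (_ : _ + _ - _ = - (expR (l * h) - 1 - l * h)); last by ring.
  rewrite normrN; apply: le_trans (ler_wpM2l (normr_ge0 _) H) _.
  rewrite (_ : `|Re c| * _ = e * `|h| * (`|Re c| / (`|Re c| + 1))); last by ring.
  apply: ler_piMr; first by rewrite mulr_ge0 // ltW.
  by rewrite ler_pdivrMr // mul1r lerDl.
exists d => // h /hd.
rewrite [X in X <= _ -> _](_ : _ = Re (\sum_(x <- s) x.1) +
  Re (\sum_(x <- s) x.1 * (x.2)%:C%C) * h - Re (esum s h 0)); first by lra.
rewrite /esum !Re_sum mulr_suml -big_split -sumrB /=; apply: eq_bigr => x _.
by rewrite /f cexp_real !ReM /= !mulr0 !subr0; ring.
Qed.

(* Linearised three lines theorem. For M(j) = sup_t Re f(j/n + i t) the five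
   point approximation of the Laplacian gives 2 M(j) <= M(j-1) + M(j+1) + o(n^-2),
   so M is convex up to o(1). *)
Lemma three_lines s (a S : R) :
  Re (\sum_(x <- s) x.1) = a ->
  (forall t, Re (esum s 0 t) <= a) -> (forall t, Re (esum s 1 t) <= S) ->
  Re (\sum_(x <- s) x.1 * (x.2)%:C%C) <= S - a.
Proof.
move=> sa s0 s1; set b := Re _; apply/ler_addgt0Pr => e e0.
have e2 : 0 < e / 2 by rewrite divr_gt0.
have [d1 d10 h1] := defect_sum_small s e2; have [d2 d20 h2] := esum_derive s e2.
(* The mesh width 1/n lies below both thresholds. *)
pose n := (Num.truncn (Num.min d1 d2)^-1).+2.
have n0 : 0 < n%:R :> R by rewrite ltr0n.
have nN0 : n%:R != 0 :> R by rewrite gt_eqF.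
pose h : R := n%:R^-1; have h0 : 0 < h by rewrite invr_gt0.
have dd0 : 0 < Num.min d1 d2 by rewrite lt_min d10.
have hd : `|h| < Num.min d1 d2.
  rewrite gtr0_norm // -(invrK (Num.min d1 d2)) ltf_pV2 ?posrE ?invr_gt0 //.
  apply: lt_trans (_ : (Num.truncn (Num.min d1 d2)^-1).+1%:R < _); last by rewrite ltr_nat.
  exact: truncnS_gt.
move: hd; rewrite lt_min => /andP[/h1 {}h1 /h2 {}h2].
pose u j t := Re (esum s (j%:R * h) t).
pose M j := sup [set u j t | t in [set: R]].
set K := \sum_(x <- s) _ in h1.
have K0 : 0 <= K.
  by apply: sumr_ge0 => x _; rewrite mulr_ge0 // mulr_ge0 ?expR_ge0 ?addr_ge0.
have jh j : (j <= n)%N -> 0 <= j%:R * h <= 1.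
  by move=> jn; rewrite mulr_ge0 ?(ltW h0) //= /h ler_pdivrMr // mul1r ler_nat.
have uM j t : (j <= n)%N -> u j t <= M j.
  move=> jn; apply: ub_le_sup; last by exists t.
  exists (\sum_(x <- s) weight x) => _ [t' _ <-]; rewrite /u /esum Re_sum.
  apply: ler_sum => x _; apply: le_trans (ler_norm _) _.
  exact/Re_mul_cexp_le/jh.
have M_le j x : (forall t, u j t <= x) -> M j <= x.
  by move=> ux; apply: ge_sup => [|_ [t _ <-] //]; exists (u j 0), 0.
have conv j : (j.+1 < n)%N -> M j.+1 *+ 2 <= M j + M j.+2 + K.
  (* The two vertical neighbours t + h and t - h lie on the line of index j.+1 itself, so they
     contribute [M j.+1] twice; solving for it gives the claim. *)
  move=> jn; suff : M j.+1 <= (M j + M j.+2 + M j.+1 *+ 2 + K) / 4 by lra.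
  apply: M_le => t.
  have := five_point s h t (jh _ (ltnW jn)).
  have -> : j.+1%:R * h + h = j.+2%:R * h by rewrite -[j.+2%:R]natr1; ring.
  have -> : j.+1%:R * h - h = j%:R * h by rewrite -natr1; ring.
  have := uM j t; have := uM j.+2 t; have := uM j.+1 (t - h); have := uM j.+1 (t + h).
  rewrite /u => a1 a2 a3 a4.
  have {}a1 := a1 (ltnW jn); have {}a2 := a2 (ltnW jn); have {}a3 := a3 jn.
  have {}a4 := a4 (ltnW (ltnW jn)); rewrite -/K; lra.
have := discrete_convex K0 conv.
have Mn : M n <= S by apply: M_le => t; rewrite /u /h mulfV.
have M0 : M 0%N <= a by apply: M_le => t; rewrite /u mul0r.
have M0' : a <= M 0%N.
  rewrite -sa; apply: le_trans (uM 0%N 0 isT); rewrite /u mul0r /esum.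
  by under [in leRHS]eq_bigr do rewrite cexp0 mulr1.
have M1 : a + b * h - e / 2 * h <= M 1%N.
  have := uM 1%N 0 isT; rewrite /u mul1r; move: h2; rewrite sa gtr0_norm //.
  exact: le_trans.
(* [K] is at most (e / 2) h^2 with h = 1/n, so the loss accumulated over the n steps is at most e /
   2. *)
have Kn : K * n%:R ^+ 2 <= e / 2.
  by rewrite -ler_pdivlMr ?exprn_gt0 // -exprVn.
have {M1} : b - e / 2 <= (M 1%N - a) *+ n.
  rewrite -[leRHS]mulr_natr -ler_pdivrMr // -/h; lra.
have -> : M 0%N = a by apply/eqP; rewrite eq_le M0 M0'.
lra.
Qed.

End ThreeLines.

(** * Rearrangements of traces *)

Section TraceIdentities.
Variable R : realType.
Local Notation C := (R[i]).
Local Notation Re := (@complex.Re R).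
Local Notation Im := (@complex.Im R).

Lemma froZ p q (c : C) (X : 'M[C]_(p, q)) :
  fro (c *: X) = (Re c ^+ 2 + Im c ^+ 2) * fro X.
Proof. by rewrite /fro adjZ -scalemxAl -scalemxAr scalerA mul_conjE rtrZ. Qed.

Lemma rtr_split n m (h g : 'M[C]_n) (L : 'M[C]_(n, m)) (K' : 'M[C]_(m, n)) (Y : 'M[C]_m) :
  rtr (h *m g *m (L *m Y *m K')) = rtr ((g *m L) *m (Y *m (K' *m h))).
Proof. by rewrite -mulmxA rtrC -!mulmxA. Qed.

Lemma conj_sandwich p (V i X : 'M[C]_p) : adj i = i ->
  V *m (i *m X *m i) *m adj V = (V *m i) *m X *m adj (V *m i).
Proof. by move=> hi; rewrite adjM hi !mulmxA. Qed.

Lemma sandwich_conj p (V i X : 'M[C]_p) : adj i = i ->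
  i *m (V *m X *m adj V) *m i = (i *m V) *m X *m adj (i *m V).
Proof. by move=> hi; rewrite adjM hi !mulmxA. Qed.

Lemma gram_mul p q r (W : 'M[C]_(p, q)) (H : 'M[C]_(q, r)) :
  (W *m H) *m adj (W *m H) = W *m (H *m adj H) *m adj W.
Proof. by rewrite adjM !mulmxA. Qed.

Lemma fro_chain p q (s d : 'M[C]_p) (L : 'M[C]_(p, q)) (Y : 'M[C]_q) : adj s = s ->
  fro (s *m d *m L *m Y) = rtr (s *m s *m (d *m (L *m (Y *m adj Y) *m adj L) *m adj d)).
Proof.
move=> hs; rewrite -!(mulmxA s) /fro -(mulmxA _ L) gram_mul hs rtrC.
by rewrite (gram_mul d) (gram_mul L) mulmxA.
Qed.

Lemma rtr_split_right p q (h s d : 'M[C]_p) (L : 'M[C]_(p, q)) (Y : 'M[C]_q)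
    (K' : 'M[C]_(q, p)) (c : C) :
  rtr ((K' *m (h *m s)) *m (c *: (s *m d *m L *m Y))) =
  rtr (h *m (c *: (s *m s)) *m d *m (L *m Y *m K')).
Proof.
rewrite -!scalemxAr -!scalemxAl /rtr !mxtraceZ; congr (Re (_ * _)).
have -> : s *m d *m L *m Y = s *m (d *m (L *m Y)) by rewrite !mulmxA.
set Z := L *m Y.
by rewrite -(mulmxA K') mxtrace_mulC !mulmxA.
Qed.

End TraceIdentities.

(** * Value, derivative and boundary bounds of the strip function *)

Section KeyInequality.
Variable R : realType.
Local Notation C := (R[i]).
Local Notation Re := (@complex.Re R).
Local Notation Im := (@complex.Im R).

Lemma mexpsum_hpow1 n (A : 'M[C]_n) :
  mexpsum (fun th t => hpow th t A) (suppmx A) ((1 / 2)%:C%C *: hlog A).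
Proof. by apply: eq_mexpsum (mexpsum_hpow A 1) => th t; rewrite !mul1r. Qed.
Lemma mexpsum_hpowN1 n (A : 'M[C]_n) :
  mexpsum (fun th t => hpow (- th) (- t) A) (suppmx A) ((-1 / 2)%:C%C *: hlog A).
Proof. by apply: eq_mexpsum (mexpsum_hpow A (-1)) => th t; rewrite !mulN1r. Qed.

Lemma suppmx_supp_le n (rho sigma : 'M[C]_n) : psd rho -> psd sigma ->
  supp_le rho sigma -> suppmx rho *m suppmx sigma = suppmx rho.
Proof.
move=> rho0 sigma0 h; have E : hpow (-2) 0 rho *m rho = suppmx rho.
  by rewrite -[X in _ *m X](hpow2 rho0) hpowM addNr addr0.
by rewrite -E -mulmxA supp_le_suppmx.
Qed.

Section Povm.
Variables (n k : nat) (M : 'I_k -> 'M[C]_n).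
Hypothesis povmM : povm M.
Let S x := hpow 1 0 (M x).

Lemma povm_sum_fro p (H : 'M[C]_(p, n)) : \sum_x fro (H *m S x) = fro H.
Proof.
case: povmM => M0 M1.
have -> : fro H = rtr (H *m (\sum_x M x) *m adj H) by rewrite M1 mulmx1.
by rewrite mulmx_sumr mulmx_suml rtr_sum; apply: eq_bigr => x _; rewrite fro_mulsqrt.
Qed.
Lemma povm_sum_froV p (H : 'M[C]_(n, p)) : \sum_x fro (S x *m H) = fro H.
Proof.
rewrite -[RHS]fro_adj -povm_sum_fro; apply: eq_bigr => x _.
by rewrite -fro_adj adjM adj_hpow0.
Qed.
(* Contractivity of [\sum_x b x *: M x] for unimodular b, with no dilation. *)
Lemma fro_povm_phase p (H : 'M[C]_(p, n)) (b : 'I_k -> C) :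
  (forall x, Re (b x) ^+ 2 + Im (b x) ^+ 2 = 1) ->
  fro (H *m \sum_x b x *: M x) <= fro H.
Proof.
(* Pairing H B with itself through the square roots of the effects bounds 2 fro (H B) by fro H + fro
   (H B). *)
case: (povmM) => M0 _ b1; set B := \sum_x _; pose W := adj (H *m B).
have : \sum_x rtr ((b x *: (H *m S x)) *m (S x *m W)) *+ 2 <=
       \sum_x (fro (b x *: (H *m S x)) + fro (S x *m W)).
  by apply: ler_sum => x _; apply: rtr_mul_le.
rewrite [X in _ <= X]big_split /= povm_sum_froV sumrMnl -rtr_sum.
under [X in _ <= X + _]eq_bigr do rewrite froZ b1 mul1r.
rewrite povm_sum_fro fro_adj.
rewrite (eq_bigr (fun x => H *m (b x *: M x) *m W)) => [|x _]; last first.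
  by rewrite -scalemxAl mulmxA -(mulmxA H) /S hpow1K // -scalemxAr -scalemxAl.
rewrite -mulmx_suml -mulmx_sumr -/B -/(fro (H *m B)); lra.
Qed.
End Povm.

Variables (n m k : nat) (N : 'M[C]_n -> 'M[C]_m) (K : 'I_k -> 'M[C]_(m, n)).
Hypothesis NE : forall X, N X = \sum_l K l *m X *m adj (K l).
Hypothesis trN : forall X, \tr (N X) = \tr X.
Variable sigma : 'M[C]_n.
Hypothesis sigma0 : psd sigma.

Definition petz_rot s := rot_petz sigma N (phasemx (- s) (N sigma)) (phasemx s sigma).

Definition relent_gap (rho : 'M[C]_n) : R :=
  rtr (rho *m (hlog rho - hlog sigma)) - rtr (N rho *m (hlog (N rho) - hlog (N sigma))).

Section Datum.
Variables (rho : 'M[C]_n) (r : nat) (M : 'I_r -> 'M[C]_n) (w : 'I_r -> R).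
Hypothesis rho0 : psd rho.
Hypothesis tr_rho : \tr rho = 1.
Hypothesis rho_sigma : supp_le rho sigma.
Hypothesis povmM : povm M.
Hypothesis w0 : forall x, 0 < w x.

(* The analytic function F of the header, at z = th + i t; all the powers
   are half powers, see [hpowC]. *)
Definition strip_povm th t := \sum_x cexp (ln (w x) / 2) th t *: M x.
Definition strip_fun th t : C :=
  \tr (rho *m hpow (- th) (- t) rho *m strip_povm th t *m hpow th t sigma *m
       ch_adj N (hpow (- th) (- t) (N sigma) *m hpow th t (N rho))).

(** Product rule at z = 0, where every power is a support projection absorbed by rho or N(rho); the
    derivative of the last factor is carried over by duality. The division by 2 comes from the half
    powers. *)
Lemma strip_expsum : exists2 b, expsum strip_fun 1 b &
  Re b = (\sum_x ln (w x) * rtr (rho *m M x) - relent_gap rho) / 2.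
Proof.
have Nrho0 := psd_channel NE rho0; have Nsigma0 := psd_channel NE sigma0.
have N_supp := supp_le_channel NE rho0 sigma0 rho_sigma.
case: (povmM) => M0 M1.
have hB : mexpsum strip_povm 1%:M (\sum_x (ln (w x) / 2)%:C%C *: M x).
  have -> : 1%:M = \sum_x 1 *: M x by rewrite -M1; apply: eq_bigr => x _; rewrite scale1r.
  by apply: mexpsum_sum => x; apply: mexpsumZ; apply: expsum_cexp.
have hY := mexpsumM (mexpsum_hpowN1 (N sigma)) (mexpsum_hpow1 (N rho)).
set Y0 := suppmx _ *m suppmx _ in hY; set Y1 := (_ *: _ *m _ + _) in hY.
have hN : mexpsum (fun th t => ch_adj N (hpow (- th) (- t) (N sigma) *m hpow th t (N rho)))
    (ch_adj N Y0) (ch_adj N Y1).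
  rewrite !(ch_adjE NE).
  apply: (eq_mexpsum (G := fun th t => \sum_l adj (K l) *m
     (hpow (- th) (- t) (N sigma) *m hpow th t (N rho)) *m K l)).
    by move=> th t; rewrite (ch_adjE NE).
  apply: mexpsum_sum => l.
  have := mexpsumM (mexpsumM (mexpsum_cst (adj (K l))) hY) (mexpsum_cst (K l)).
  by rewrite mul0mx mulmx0 add0r addr0.
have := expsum_tr (mexpsumM (mexpsumM (mexpsumM (mexpsumM (mexpsum_cst rho)
  (mexpsum_hpowN1 rho)) hB) (mexpsum_hpow1 sigma)) hN).
have rs : rho *m suppmx sigma = rho by exact: supp_le_suppmx.
have sr : suppmx sigma *m rho = rho.
  by have := congr1 (@adj _ _ _) rs; rewrite adjM adj_suppmx psd_adj.
have Y0E : Y0 = suppmx (N rho).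
  rewrite /Y0 -[RHS]adj_suppmx -[in RHS](suppmx_supp_le Nrho0 Nsigma0 N_supp).
  by rewrite adjM !adj_suppmx.
have Er : ch_adj N Y0 *m rho = rho by rewrite Y0E; exact: ch_adj_supp_mul.
rewrite mul0mx add0r !mulmx1 !(mul_suppmx rho0) rs.
have trE : \tr (rho *m ch_adj N Y0) = 1 by rewrite mxtrace_mulC Er tr_rho.
rewrite [X in expsum _ X]trE.
set b := (X in expsum _ _ X); exists b => //.
rewrite -[Re b]/(rtr _) !mulmxDl !rtrD.
have cyc (X : 'M[C]_n) : rtr (rho *m X *m ch_adj N Y0) = rtr (rho *m X).
  by rewrite rtrC mulmxA Er.
have cycs (X : 'M[C]_n) : rtr (rho *m X *m suppmx sigma *m ch_adj N Y0) = rtr (rho *m X).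
  by rewrite -(mulmxA rho X) cyc mulmxA rtrC mulmxA sr.
rewrite cycs cycs cyc [X in _ + X](congr1 Re (ch_adj_dual NE rho Y1)) -/(rtr _).
rewrite mulmxDr rtrD (mulmxA _ (suppmx (N sigma))) (supp_le_suppmx Nsigma0 N_supp).
have -> : rtr (N rho *m ((-1 / 2)%:C%C *: hlog (N sigma) *m suppmx (N rho))) =
    -1 / 2 * rtr (N rho *m hlog (N sigma)).
  by rewrite mulmxA rtrC mulmxA (suppmx_mul Nrho0) -scalemxAr rtrZ.
rewrite -!scalemxAr !rtrZ mulmx_sumr rtr_sum.
have -> : \sum_x rtr (rho *m ((ln (w x) / 2)%:C%C *: M x)) =
    (\sum_x ln (w x) * rtr (rho *m M x)) / 2.
  rewrite mulr_suml; apply: eq_bigr => x _.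
  by rewrite -scalemxAr rtrZ mulrAC.
by rewrite /relent_gap !mulmxBr !rtrB; lra.
Qed.

(** On this line the imaginary powers are contractions. Writing rho as h h splits the trace over the
    Kraus index into pairings of two families whose squared norms each sum to at most fro h = 1. *)
Lemma strip_fun_left t : Re (strip_fun 0 t) <= 1.
Proof.
rewrite /strip_fun oppr0 (ch_adjE NE) mulmx_sumr -[Re _]/(rtr _) rtr_sum.
set Y := _ *m hpow 0 t (N rho).
pose h := hpow 1 0 rho; pose E := h *m hpow 0 (- t) rho *m strip_povm 0 t *m hpow 0 t sigma.
have h1 : fro h = 1 by rewrite /h fro_hpow1 // /rtr tr_rho.
have E1 : fro E <= 1.
  rewrite -h1; apply: le_trans (fro_unit_hpow _ _ _) _.
  apply: le_trans (fro_unit_hpow _ _ _).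
  apply: fro_povm_phase => // x.
  by rewrite /cexp mulr0 expR0 /= !mul1r cos2Dsin2.
have Y1 : \sum_l fro (Y *m (K l *m h)) <= 1.
  rewrite -h1 -(sum_fro_kraus NE trN h); apply: ler_sum => l _.
  by rewrite /Y -mulmxA; apply: le_trans (fro_hpow_unit _ _ _) (fro_hpow_unit _ _ _).
have E2 : \sum_l fro (E *m adj (K l)) <= 1.
  rewrite (eq_bigr (fun l => fro (K l *m adj E))) => [|l _]; last first.
    by rewrite -fro_adj adjM adjK.
  by rewrite (sum_fro_kraus NE trN) fro_adj.
rewrite (eq_bigr (fun l => rtr ((E *m adj (K l)) *m (Y *m (K l *m h))))) => [|l _].
  have : \sum_l rtr ((E *m adj (K l)) *m (Y *m (K l *m h))) *+ 2 <=
     \sum_l (fro (E *m adj (K l)) + fro (Y *m (K l *m h))).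
    by apply: ler_sum => l _; apply: rtr_mul_le.
  by rewrite sumrMnl [X in _ <= X]big_split /=; lra.
rewrite -rtr_split; congr (rtr (_ *m _)).
by rewrite /E -!mulmxA [RHS]mulmxA hpow1K.
Qed.

(** [Y] is the argument of [ch_adj N] in [strip_fun] at 1 + i t; the imaginary power of N(rho)
    cancels in [Y *m adj Y]. *)
Lemma petz_rotE t :
  let Y := hpow (-1) (- t) (N sigma) *m hpow 1 t (N rho) in
  petz_rot t (N rho) =
  hpow 1 t sigma *m ch_adj N (Y *m adj Y) *m adj (hpow 1 t sigma).
Proof.
have Nrho0 := psd_channel NE rho0.
rewrite /= /petz_rot /rot_petz /petz mxinvsqrtE (mxsqrtE sigma0).
rewrite (conj_sandwich _ _ (adj_hpow0 sigma 1)) (phase_hpow sigma 1 t).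
congr (hpow 1 t sigma *m ch_adj N _ *m adj (hpow 1 t sigma)).
rewrite (sandwich_conj _ _ (adj_hpow0 (N sigma) (-1))) hpow_phase [RHS]gram_mul; congr (_ *m _ *m _).
by rewrite adj_hpow hpowM subrr hpow2.
Qed.

Lemma strip_fun_right t :
  Re (strip_fun 1 t) *+ 2 <= 1 + \sum_x w x * rtr (M x *m petz_rot t (N rho)).
Proof.
rewrite /strip_fun (ch_adjE NE) mulmx_sumr -[Re _]/(rtr _).
rewrite petz_rotE /=; set Y := _ *m hpow 1 t (N rho).
pose h := hpow 1 (- t) rho; pose S x := hpow 1 0 (M x); pose D := hpow 1 t sigma.
pose c x := cexp (ln (w x) / 2) 1 t.
case: (povmM) => M0 _.
have h1 : fro h = 1 by rewrite /h fro_hpow1 // /rtr tr_rho.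
(* The trace is the sum over x and l of the pairings of [X1] and [X2]. The squared norms of the [X1]
   sum to fro h = 1, and |c x|^2 = w x turns those of the [X2] into the weighted traces. *)
pose X1 x l := K l *m (h *m S x).
pose X2 x l := c x *: (S x *m D *m adj (K l) *m Y).
have S1 : \sum_x \sum_l fro (X1 x l) = 1.
  rewrite -h1 -(povm_sum_fro povmM h); apply: eq_bigr => x _.
  exact: (sum_fro_kraus NE trN).
have S2 : \sum_x \sum_l fro (X2 x l) =
    \sum_x w x * rtr (M x *m (D *m ch_adj N (Y *m adj Y) *m adj D)).
  apply: eq_bigr => x _; rewrite (ch_adjE NE) mulmx_sumr mulmx_suml mulmx_sumr.
  rewrite rtr_sum mulr_sumr; apply: eq_bigr => l _.
  rewrite /X2 froZ sqr_cexp1 //; congr (_ * _).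
  by rewrite (fro_chain _ _ _ (adj_hpow0 (M x) 1)) (hpow1K (M0 x)) adjK.
have : \sum_x \sum_l rtr (X1 x l *m X2 x l) *+ 2 <=
       \sum_x \sum_l (fro (X1 x l) + fro (X2 x l)).
  by apply: ler_sum => x _; apply: ler_sum => l _; apply: rtr_mul_le.
under [X in _ <= X]eq_bigr do rewrite big_split /=.
rewrite [X in _ <= X]big_split /= S1 S2; apply: le_trans.
under [leRHS]eq_bigr do rewrite sumrMnl.
rewrite sumrMnl le_eqVlt; apply/orP; left; apply/eqP; congr (_ *+ 2).
rewrite rtr_sum exchange_big /=; apply: eq_bigr => l _.
rewrite /strip_povm mulmx_sumr !mulmx_suml rtr_sum; apply: eq_bigr => x _.
have -> : rho *m hpow (- 1) (- t) rho = h.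
  by rewrite -[X in X *m _](hpow2 rho0) hpowM add0r (_ : 2 + -1 = 1) //; lra.
by rewrite rtr_split_right hpow1K.
Qed.
End Datum.
End KeyInequality.

(** * A minimax theorem for convex combinations *)

Section Minimax.
Variable R : realType.
Local Open Scope classical_set_scope.

Lemma continuous_sum (S : topologicalType) I (r : seq I) (F : I -> S -> R) :
  (forall i, continuous (F i)) -> continuous (fun x => \sum_(i <- r) F i x).
Proof.
move=> cF; elim: r => [|i r ih].
  rewrite (_ : (fun _ => _) = fun _ => 0); last by apply/funext => x; rewrite big_nil.
  by move=> x; exact: cvg_cst.
rewrite (_ : (fun _ => _) = (F i \+ fun x => \sum_(i <- r) F i x)).
  by move=> x; apply: cvgD; [exact: cF|exact: ih].
by apply/funext => x; rewrite big_cons.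
Qed.

Lemma continuous_const (S : topologicalType) (y : R) : continuous (fun _ : S => y).
Proof. by move=> x; exact: cvg_cst. Qed.
Lemma continuous_sub (S : topologicalType) (f g : S -> R) :
  continuous f -> continuous g -> continuous (fun x => f x - g x).
Proof. by move=> cf cg x; apply: cvgB; [exact: cf|exact: cg]. Qed.
Lemma continuous_add_norm (S : topologicalType) (f : S -> R) :
  continuous f -> continuous (fun x => f x + `|f x|).
Proof. by move=> cf x; apply: cvgD; [exact: cf|apply: cvg_norm; exact: cf]. Qed.
Lemma continuous_mul (S : topologicalType) (f g : S -> R) :
  continuous f -> continuous g -> continuous (fun x => f x * g x).
Proof. by move=> cf cg x; apply: cvgM; [exact: cf|exact: cg]. Qed.

(* Caratheodory: subtracting a suitable multiple of an affine dependency of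
   d + 2 points of R^d removes one of them from a convex combination. *)
Lemma caratheodory_step d (s : 'I_d.+2 -> 'I_d -> R) (p : 'I_d.+2 -> R) :
  (forall j, 0 <= p j) -> \sum_j p j = 1 ->
  exists (j0 : 'I_d.+2) (q : 'I_d.+1 -> R), [/\ forall j, 0 <= q j, \sum_j q j = 1 &
    forall k, \sum_j q j * s (lift j0 j) k = \sum_j p j * s j k].
Proof.
move=> p0 p1.
(* There are more rows than columns, and the constant column forces the coefficients of a row
   dependency to sum to 0. *)
pose A := \matrix_(j < d.+2, l < d.+1) (if unlift ord0 l is Some k then s j k else 1).
have /rowV0Pn [v vK v0] : kermx A != 0.
  by rewrite -mxrank_eq0 mxrank_ker -lt0n subn_gt0; apply: leq_ltn_trans (rank_leq_col _) _.
have vA : v *m A = 0 by apply/sub_kermxP.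
have v1 : \sum_j v 0 j = 0.
  have /matrixP /(_ 0 ord0) := vA; rewrite !mxE => h; rewrite -[RHS]h; apply: eq_bigr => j _.
  by rewrite mxE unlift_none mulr1.
have vs k : \sum_j v 0 j * s j k = 0.
  have /matrixP /(_ 0 (lift ord0 k)) := vA; rewrite !mxE => h; rewrite -[RHS]h; apply: eq_bigr => j _.
  by rewrite mxE liftK.
have [j1 vj1] : exists j, 0 < v 0 j.
  apply/existsP; rewrite -[X in is_true X]negbK negb_exists; apply/negP => /forallP h.
  move/negP: v0; apply; apply/eqP/rowP => j; rewrite mxE.
  have h' i : 0 <= - v 0 i by rewrite oppr_ge0 leNgt.
  have /eqP : \sum_j - v 0 j = 0 by rewrite sumrN v1 oppr0.
  rewrite psumr_eq0 => [/allP /(_ j)|i _ //].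
  by rewrite mem_index_enum => /(_ isT) /=; rewrite oppr_eq0 => /eqP.
(* The least ratio is the largest multiple of v that can be subtracted with all weights remaining
   nonnegative; it annihilates the weight of [j0]. *)
have [j0 vj0 jmin] : exists2 j0, 0 < v 0 j0 & forall j, 0 < v 0 j -> p j0 / v 0 j0 <= p j / v 0 j.
  case: (@arg_minP _ _ _ j1 (fun j => 0 < v 0 j) (fun j => p j / v 0 j) vj1) => j0 h1 h2.
  by exists j0.
pose a := p j0 / v 0 j0; have a0 : 0 <= a by rewrite divr_ge0 // ltW.
pose q j := p j - a * v 0 j.
have q0 : q j0 = 0 by rewrite /q /a mulfVK ?subrr // gt_eqF.
have E (F : 'I_d.+2 -> R) : \sum_j q (lift j0 j) * F (lift j0 j) =
    \sum_j p j * F j - a * \sum_j v 0 j * F j.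
  transitivity (\sum_j q j * F j); first by rewrite (bigD1_ord j0) //= q0 mul0r add0r.
  rewrite mulr_sumr -sumrB; apply: eq_bigr => j _; rewrite /q; ring.
exists j0, (fun j => q (lift j0 j)); split=> [j||k].
- rewrite /q subr_ge0; have [vj|vj] := ltP 0 (v 0 (lift j0 j)).
    by rewrite -ler_pdivlMr // jmin.
  by apply: le_trans (p0 _); rewrite mulr_ge0_le0.
- have := E (fun _ => 1); under eq_bigr do rewrite mulr1; move=> ->.
  under eq_bigr do rewrite mulr1; under [X in _ * X]eq_bigr do rewrite mulr1.
  by rewrite p1 v1 mulr0 subr0.
- by rewrite (E (fun j => s j k)) vs mulr0 subr0.
Qed.

Section ConvexCombinations.
Variables (L d : nat) (B : R) (phi : 'I_d -> 'rV[R]_L -> R).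
Hypothesis B0 : 0 <= B.
(** Continuity along arbitrary maps with continuous coordinates: in this form it composes directly
    with the point maps [pointp]. *)
Hypothesis phi_cont : forall k (S : topologicalType) (u : S -> 'rV[R]_L),
  (forall l, continuous (fun s => u s 0 l)) -> continuous (fun s => phi k (u s)).
Variables (I : Type) (a : I -> 'I_d -> R) (c : I -> R).
Let g i s := \sum_k a i k * phi k s.
Let box (s : 'rV[R]_L) := forall l, `|s 0 l| <= B.
(** The sum of lam c is at most the supremum over the box of the sum of lam g, expressed through
    upper bounds x. *)
Hypothesis dual : forall q (lam : 'I_q -> R) (D : 'I_q -> I) x,
  (forall j, 0 <= lam j) -> (forall s, box s -> \sum_j lam j * g (D j) s <= x) ->
  \sum_j lam j * c (D j) <= x.

Local Notation J := (d.+1 * L.+1)%N.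
(* A vector of dimension d.+1 * L.+1 encodes d.+1 weighted points of R^L. *)
Definition weightp (f : 'rV[R]_J) (j : 'I_d.+1) : R := f 0 (mxtens_index (j, ord0)).
Definition pointp (f : 'rV[R]_J) (j : 'I_d.+1) : 'rV[R]_L :=
  \row_l f 0 (mxtens_index (j, lift ord0 l)).
Definition paramp (p : 'I_d.+1 -> R) (s : 'I_d.+1 -> 'rV[R]_L) : 'rV[R]_J :=
  \row_x let: (j, o) := mxtens_unindex x in
    if unlift ord0 o is Some l then s j 0 l else p j.
Definition simplexp : set 'rV[R]_J :=
  [set f : 'rV[R]_J | forall x, (if unlift ord0 (mxtens_unindex x).2 is Some _
                      then `[- B, B] else `[0, 1]) (f 0 x)] `&`
  [set f : 'rV[R]_J | \sum_j weightp f j = 1].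
Definition meanp i (f : 'rV[R]_J) := \sum_j weightp f j * g i (pointp f j).

Lemma weight_paramp p s j : weightp (paramp p s) j = p j.
Proof. by rewrite /weightp mxE mxtens_indexK unlift_none. Qed.
Lemma point_paramp p s j : pointp (paramp p s) j = s j.
Proof. by apply/rowP => l; rewrite !mxE mxtens_indexK liftK. Qed.
Lemma coord_cont x : continuous (fun f : 'rV[R]_J => f 0 x).
Proof. exact: coord_continuous. Qed.
Lemma weight_cont j : continuous (fun f : 'rV[R]_J => weightp f j).
Proof. exact: coord_continuous. Qed.
Lemma mean_cont i : continuous (meanp i).
Proof.
apply: continuous_sum => j; apply: continuous_mul; first exact: weight_cont.
apply: continuous_sum => k; apply: continuous_mul; first exact: continuous_const.
apply: phi_cont => l.
rewrite (_ : (fun _ => _) = fun f : 'rV[R]_J => f 0 (mxtens_index (j, lift ord0 l))).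
  exact: coord_cont.
by apply/funext => h; rewrite mxE.
Qed.
Lemma simplex_compact : compact simplexp.
Proof.
apply: compact_closedI.
  apply: (@rV_compact R J (fun x => if unlift ord0 (mxtens_unindex x).2 is Some _
                                    then `[- B, B] else `[0, 1])) => x.
  by case: unlift => *; apply: segment_compact.
rewrite (_ : [set f | _] = (fun f => \sum_j weightp f j) @^-1` [set x | x = 1]) //.
apply: preimage_closed; last exact: closed_eq.
move=> f _; move: f.
by apply: continuous_sum => j; apply: weight_cont.
Qed.
Lemma simplexpP f : simplexp f <->
  [/\ forall j, 0 <= weightp f j, \sum_j weightp f j = 1 & forall j, box (pointp f j)].
Proof.
split=> [[fb f1]|[f0 f1 fb]].
  split=> // [j|j l].
    by have := fb (mxtens_index (j, ord0)); rewrite mxtens_indexK unlift_none /= in_itv => /andP[].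
  have := fb (mxtens_index (j, lift ord0 l)).
  by rewrite mxtens_indexK liftK /= in_itv /= mxE ler_norml.
split=> // x; rewrite -(mxtens_unindexK x); case: (mxtens_unindex x) => j o.
rewrite mxtens_indexK [(j, o).2]/=; case: unliftP => [l ->|->] /=; rewrite in_itv /=.
  by have := fb j l; rewrite mxE ler_norml.
rewrite f0 /= -[leRHS]f1 (bigD1 j) //= lerDl.
by apply: sumr_ge0.
Qed.

(** Mixing in s0 produces d.+2 weighted points; as each g i sees only the d numbers [phi k],
    Caratheodory brings them back to d.+1. Thus the means form a convex set although [simplexp] has
    a fixed number of points. *)
Lemma mean_extend f s0 e : simplexp f -> box s0 -> 0 <= e <= 1 ->
  exists2 f', simplexp f' & forall i, meanp i f' = (1 - e) * meanp i f + e * g i s0.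
Proof.
move=> /simplexpP[f0 f1 fb] s0b /andP[e0 e1].
pose s (j : 'I_d.+2) := if unlift ord0 j is Some j' then pointp f j' else s0.
pose p (j : 'I_d.+2) := if unlift ord0 j is Some j' then (1 - e) * weightp f j' else e.
have big (F : 'I_d.+2 -> R) : \sum_j F j = F ord0 + \sum_j F (lift ord0 j).
  by rewrite big_ord_recl.
have p0 j : 0 <= p j by rewrite /p; case: unliftP => // *; rewrite mulr_ge0 // subr_ge0.
have p1 : \sum_j p j = 1.
  rewrite big /p unlift_none; under eq_bigr do rewrite liftK.
  by rewrite -mulr_sumr f1 mulr1 addrC subrK.
have [j0 [q [q0 q1 qs]]] := caratheodory_step (fun j k => phi k (s j)) p0 p1.
exists (paramp q (fun j => s (lift j0 j))).
  apply/simplexpP; split=> [j||j]; rewrite ?weight_paramp // ?point_paramp.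
    by under eq_bigr do rewrite weight_paramp.
  by rewrite /s; case: unliftP.
move=> i; rewrite /meanp /g.
under eq_bigr do rewrite weight_paramp point_paramp mulr_sumr.
rewrite exchange_big /=.
under eq_bigr => k _.
  under eq_bigr do rewrite mulrCA.
  rewrite -mulr_sumr qs big /p /s unlift_none.
  under eq_bigr do rewrite liftK.
  rewrite mulrDr; over.
rewrite big_split /= addrC; congr (_ + _).
  rewrite mulr_sumr; under [RHS]eq_bigr do rewrite !mulr_sumr.
  rewrite [RHS]exchange_big /=; apply: eq_bigr => k _.
  by rewrite mulr_sumr; apply: eq_bigr => j _; ring.
by rewrite mulr_sumr; apply: eq_bigr => k _; ring.
Qed.

Lemma simplexp_nonempty : simplexp !=set0.
Proof.
exists (paramp (fun j => (j == ord0)%:R) (fun _ => 0)); apply/simplexpP.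
split=> [j||j l]; rewrite ?weight_paramp ?ler0n // ?point_paramp ?mxE ?normr0 //.
rewrite (bigD1 ord0) //= weight_paramp big1 ?addr0 // => j /negPf jn.
by rewrite weight_paramp jn.
Qed.

(* A minimiser f of the squared violation of the constraints is a solution: the
   violations lam satisfy grad below by first order optimality, and then the
   hypothesis [dual] forces lam = 0. *)
Lemma finite_minimax q (D : 'I_q -> I) :
  exists2 f, simplexp f & forall j, c (D j) <= meanp (D j) f.
Proof.
pose pos (y : R) := (y + `|y|) / 2.
have pos0 y : 0 <= pos y by have := ler_norm (- y); rewrite normrN /pos; lra.
have posE y : pos y * y = pos y ^+ 2.
  rewrite /pos; case: (ger0P y) => _; last by rewrite subrr !mul0r expr0n.
  by rewrite -mulr2n -[y *+ 2]mulr_natr mulfK.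
have pos_eq0 y : pos y = 0 -> y <= 0.
  by rewrite /pos; case: (ger0P y) => ? h; lra.
(* Dominates the perturbed squared violation by a quadratic polynomial, in place of differentiating
   the squared positive part. *)
have pos_sub y u : pos (y - u) ^+ 2 <= (pos y - u) ^+ 2.
  rewrite -real_normK ?num_real // -[leRHS]real_normK ?num_real // ler_sqr ?nnegrE //.
  rewrite (ger0_norm (pos0 _)) /pos.
  by case: (ger0P y) => y0; case: (ger0P (y - u)) => yu; case: ger0P; lra.
pose h f := \sum_j pos (c (D j) - meanp (D j) f) ^+ 2.
have hc : continuous h.
  apply: continuous_sum => j.
  have cp : continuous (fun f => pos (c (D j) - meanp (D j) f)).
    rewrite /pos; apply: continuous_mul; last exact: continuous_const.
    apply: continuous_add_norm; apply: continuous_sub; last exact: mean_cont.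
    exact: continuous_const.
  rewrite (_ : (fun _ => _) = fun f => pos (c (D j) - meanp (D j) f) * pos (c (D j) - meanp (D j) f)).
    exact: continuous_mul.
  by apply/funext => f; rewrite expr2.
have [f /set_mem fS fmin] := compact_EVT_min simplexp_nonempty simplex_compact
  (continuous_subspaceT hc).
exists f => //; pose lam j := pos (c (D j) - meanp (D j) f).
have grad s : box s -> \sum_j lam j * g (D j) s <= \sum_j lam j * meanp (D j) f.
  move=> sb; rewrite -subr_le0 -sumrB.
  pose u j := g (D j) s - meanp (D j) f; set U := \sum_j u j ^+ 2.
  have U0 : 0 <= U by apply: sumr_ge0 => j _; apply: sqr_ge0.
  have key e : 0 < e <= 1 -> (\sum_j lam j * u j) *+ 2 <= e * U.
    move=> /andP[e0 e1]; have e01 : 0 <= e <= 1 by rewrite ltW.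
    have [f' f'S f'E] := mean_extend fS sb e01.
    have hle := fmin f' (mem_set f'S).
    have : h f <= \sum_j (lam j ^+ 2 - e * (lam j * u j) *+ 2 + e ^+ 2 * u j ^+ 2).
      apply: le_trans hle _; apply: ler_sum => j _.
      rewrite f'E (_ : c (D j) - _ = (c (D j) - meanp (D j) f) - e * u j).
        apply: le_trans (pos_sub _ _) _; rewrite -/(lam j).
        have -> // : (lam j - e * u j) ^+ 2 = lam j ^+ 2 - e * (lam j * u j) *+ 2 + e ^+ 2 * u j ^+ 2.
        by ring.
      by rewrite /u; ring.
    rewrite big_split sumrB /= -mulr_sumr sumrMnl -mulr_sumr -/U /h => H.
    rewrite -(ler_pM2l e0); move: H; set X := \sum_j _ ^+ 2; lra.
  rewrite (eq_bigr (fun j => lam j * u j)) => [|j _]; last by rewrite mulrBr.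
  rewrite leNgt; apply/negP; set Z := \sum_j _ => Z0.
  have ZU : 0 < Z + U + 1 by rewrite ltr_wpDl ?addr_ge0 // ltW.
  (* This step size e lies in (0, 1] and satisfies e U < Z, contradicting [key]. *)
  have := key (Z / (Z + U + 1)); rewrite divr_gt0 // ler_pdivrMr // mul1r.
  have -> : Z <= Z + U + 1 by rewrite -addrA lerDl addr_ge0.
  move=> /(_ isT); rewrite -/Z mulrAC ler_pdivlMr //; nra.
have := dual (D := D) (fun j => pos0 _ : 0 <= lam j) grad.
rewrite -subr_le0 -sumrB => sum_le.
have sq : \sum_j lam j ^+ 2 = 0.
  apply/eqP; rewrite eq_le sumr_ge0 ?andbT; last by move=> *; apply: sqr_ge0.
  apply: le_trans sum_le; apply: ler_sum => j _.
  by rewrite -mulrBr /lam posE.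
move=> j; rewrite -subr_le0; apply: pos_eq0; apply/eqP; rewrite -sqrf_eq0.
move: sq => /eqP; rewrite psumr_eq0 => [/allP /(_ j)|i _]; last exact: sqr_ge0.
by rewrite mem_index_enum => /(_ isT).
Qed.

(** Compactness extends the finite case to all constraints: the solution sets are closed in
    [simplexp] and have the finite intersection property. *)
Theorem minimax : exists (p : 'I_d.+1 -> R) (s : 'I_d.+1 -> 'rV[R]_L),
  [/\ forall j, 0 <= p j, \sum_j p j = 1, forall j, box (s j) &
      forall i, c i <= \sum_j p j * g i (s j)].
Proof.
suff [f /simplexpP[f0 f1 fb] cf] : exists2 f, simplexp f & forall i, c i <= meanp i f.
  by exists (weightp f), (pointp f).
(* An empty family is treated apart, since membership in [simplexp] is read off from one of the sets
   [F i]. *)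
have [[i0]|I0] := pselect (inhabited I); last first.
  by have [f fS] := simplexp_nonempty; exists f => // i; case: I0.
pose F (i : {classic I}) := simplexp `&` [set f | c i <= meanp i f].
have F_closed : closed_fam_of simplexp setT F.
  exists (fun i => [set f | c i <= meanp i f]) => // i _.
  rewrite (_ : [set f | _] = meanp i @^-1` [set x | c i <= x]) //.
  by apply: preimage_closed; [move=> f _; exact: mean_cont|exact: closed_ge].
have F_finI : finI setT F.
  move=> r _; have [f fS hf] := finite_minimax (fun j : 'I_(size r) => tnth (in_tuple r) j).
  exists f => i /= ir; split=> //.
  have /tnthP [j ->] : i \in in_tuple r by [].
  exact: hf.
have := simplex_compact; rewrite compact_In0.
move=> /(_ _ _ _ F_closed F_finI) [f hf].
exists f => [|i]; first by have [] := hf i0 Logic.I.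
by have [] := hf i Logic.I.
Qed.
End ConvexCombinations.
End Minimax.

(* A state together with a weighted POVM, i.e. a linear constraint on the
   sought recovery map. *)
Record datum (R : realType) n (sigma : 'M[R[i]]_n) := Datum {
  state : 'M[R[i]]_n;
  outcomes : nat;
  effect : 'I_outcomes -> 'M[R[i]]_n;
  weight_of : 'I_outcomes -> R;
  state_density : density state;
  state_supp : supp_le state sigma;
  effect_povm : povm effect;
  weight_gt0 : forall x, 0 < weight_of x }.
Arguments effect {R n sigma} d _.
Arguments weight_of {R n sigma} d _.
Arguments weight_gt0 {R n sigma} d _.

(** * Averaged data and the torus of rotations *)

Section UniversalRecovery.
Variable R : realType.
Local Notation C := (R[i]).
Local Notation Re := (@complex.Re R).
Variables (n m k : nat) (N : 'M[C]_n -> 'M[C]_m) (K : 'I_k -> 'M[C]_(m, n)).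
Hypothesis NE : forall X, N X = \sum_l K l *m X *m adj (K l).
Hypothesis trN : forall X, \tr (N X) = \tr X.
Variable sigma : 'M[C]_n.
Hypothesis sigma0 : psd sigma.

Definition test (D : datum sigma) (X : 'M[C]_n) : R :=
  \sum_x weight_of D x * rtr (effect D x *m X).
Definition level (D : datum sigma) : R :=
  \sum_x ln (weight_of D x) * rtr (state D *m effect D x) - relent_gap N sigma (state D) + 1.

(** Hypothesis [dual] of the minimax theorem along the rotated Petz maps. The combination of the
    strip functions is again an exponential sum, with value sum lam at 0, real part at most sum lam
    on the left line and at most (sum lam + x) / 2 on the right one. *)
Lemma family_bound q (lam : 'I_q -> R) (D : 'I_q -> datum sigma) x :
  (forall j, 0 <= lam j) ->
  (forall t, \sum_j lam j * test (D j) (petz_rot N sigma t (N (state (D j)))) <= x) ->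
  \sum_j lam j * level (D j) <= x.
Proof.
move=> lam0 hx.
pose f j := strip_fun N sigma (state (D j)) (effect (D j)) (weight_of (D j)).
have bP j : exists b, expsum (f j) 1 b /\ Re b = (level (D j) - 1) / 2.
  have [rho0 tr1] := state_density (D j).
  have [b fb bE] := strip_expsum NE trN sigma0 (weight_of (D j)) rho0 tr1
    (state_supp (D j)) (effect_povm (D j)).
  by exists b; split=> //; rewrite bE /level addrK.
have [b hb] := choice bP.
have hs := expsum_sum (index_enum 'I_q) (fun j => expsumM (expsum_cst (lam j)%:C%C) (proj1 (hb j))).
case: hs => s [sE s1 sb].
have a1 : Re (\sum_(y <- s) y.1) = \sum_j lam j.
  by rewrite -s1 Re_sum; apply: eq_bigr => j _; rewrite mulr1.
have left t : Re (esum s 0 t) <= \sum_j lam j.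
  rewrite -sE Re_sum; apply: ler_sum => j _; rewrite ReZ -[leRHS]mulr1.
  apply: ler_wpM2l => //; case: (state_density (D j)) => rho0 tr1.
  exact: (strip_fun_left NE trN sigma (weight_of (D j)) rho0 tr1 (effect_povm (D j)) t).
have right t : Re (esum s 1 t) <= (\sum_j lam j + x) / 2.
  rewrite -sE Re_sum.
  apply: (@le_trans _ _ ((\sum_j lam j + \sum_j lam j * test (D j) (petz_rot N sigma t (N (state (D j))))) / 2)); last first.
    by have := hx t; lra.
  rewrite -big_split /= mulr_suml; apply: ler_sum => j _; rewrite ReZ.
  case: (state_density (D j)) => rho0 tr1.
  have := strip_fun_right NE trN sigma0 rho0 tr1 (effect_povm (D j)) (weight_gt0 (D j)) t.
  rewrite -/(test _ _) -/(f j) => h.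
  have := ler_wpM2l (lam0 j) h; lra.
have := three_lines a1 left right.
rewrite -sb Re_sum (eq_bigr (fun j => (lam j * level (D j) - lam j) / 2)) => [|j _]; last first.
  by rewrite ReD mul0r add0r ReZ (proj2 (hb j)); ring.
by rewrite -mulr_suml sumrB; lra.
Qed.

Definition cis (x : R) : C := (cos x +i* sin x)%C.
(** Independent phases in the eigenbasis of A. Unlike the imaginary powers of A, they are
    parametrised by a compact set of angles. *)
Definition rotmx p (A : 'M[C]_p) (th : 'I_p -> R) : 'M[C]_p :=
  adj (spectralmx A) *m diag_mx (\row_i cis (th i)) *m spectralmx A.

Lemma mul_conj_cis x : cis x * (cis x)^* = 1.
Proof. by rewrite mul_conjE /= cos2Dsin2. Qed.
Lemma conj_mul p (Q P D : 'M[C]_p) : Q *m adj Q = 1%:M ->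
  (adj Q *m P *m Q) *m (adj Q *m D *m Q) = adj Q *m (P *m D) *m Q.
Proof.
move=> QQ; rewrite -!(mulmxA (adj Q)) -(mulmxA P) (mulmxA Q) QQ mul1mx.
by rewrite -mulmxA.
Qed.
Lemma rotmx_unitary p (A : 'M[C]_p) th : unitary (rotmx A th).
Proof.
rewrite /unitary /rotmx; set Q := spectralmx A; set P := diag_mx _.
have -> : adj (adj Q *m P *m Q) = adj Q *m adj P *m Q by rewrite !adjM adjK mulmxA.
rewrite conj_mul ?spectralmxKV // adj_diag mulmx_diag.
rewrite (_ : diag_mx _ = 1%:M) ?mulmx1 ?spectralmxK //.
by apply/matrixP=> i j; rewrite !mxE mul_conj_cis.
Qed.
Lemma rotmx_comm p (A : 'M[C]_p) th : adj A = A -> rotmx A th *m A = A *m rotmx A th.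
Proof.
move=> hA.
have AE : A = adj (spectralmx A) *m diag_mx (spectral_diag A) *m spectralmx A.
  by rewrite -[LHS](mxfun_id hA) mxfunE map_mx_id.
rewrite [X in _ *m X = _]AE [X in _ = X *m _]AE /rotmx.
rewrite !(conj_mul _ _ (spectralmxKV A)).
by rewrite diag_mxC.
Qed.
Lemma circle_angle (a b : R) : a ^+ 2 + b ^+ 2 = 1 ->
  exists x, [/\ `|x| <= pi, cos x = a & sin x = b].
Proof.
move=> ab; have a1 : -1 <= a <= 1.
  by rewrite -ler_norml -ler_sqr ?nnegrE // expr1n real_normK ?num_real // -ab lerDl sqr_ge0.
have [/andP[x0 xpi] cx] := acos_def a1; have sx := sin_acos a1.
have {}sx : sin (acos a) = `|b| by rewrite sx -ab addrAC subrr add0r sqrtr_sqr.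
have [b0|b0] := ger0P b.
  by exists (acos a); split; rewrite ?ger0_norm // sx ger0_norm.
exists (- acos a); split; rewrite ?normrN ?ger0_norm ?cosN // sinN sx.
by rewrite ltr0_norm // opprK.
Qed.
(** Reducing the angles to [-pi, pi] puts the rotations for all t in one bounded box. *)
Lemma phasemx_rotmx p (A : 'M[C]_p) t :
  exists2 th : 'I_p -> R, forall i, `|th i| <= pi & phasemx t A = rotmx A th.
Proof.
have [th hth] := choice (fun i : 'I_p => circle_angle (norm_phaseC t (spectral_diag A 0 i))).
exists th => [i|]; first by case: (hth i).
rewrite phasemx.unlock mxfunE /rotmx; congr (_ *m diag_mx _ *m _).
apply/rowP=> i; rewrite !mxE /cis; have [_ -> ->] := hth i.
by case: phaseC.
Qed.
End UniversalRecovery.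

(** * Entrywise continuity of complex matrices, by real and imaginary parts *)

Section ContinuousMatrices.
Variable R : realType.
Local Notation C := (R[i]).
Local Notation Re := (@complex.Re R).
Local Notation Im := (@complex.Im R).
Variable S : topologicalType.
Local Open Scope classical_set_scope.

Definition ccont (f : S -> C) :=
  continuous (fun s => Re (f s)) /\ continuous (fun s => Im (f s)).
Definition mcont p q (F : S -> 'M[C]_(p, q)) := forall i j, ccont (fun s => F s i j).

Lemma continuous_ext (f g : S -> R) : f =1 g -> continuous g -> continuous f.
Proof. by move=> /funext ->. Qed.
Lemma continuous_add (f g : S -> R) :
  continuous f -> continuous g -> continuous (fun x => f x + g x).
Proof. by move=> cf cg x; apply: cvgD; [exact: cf|exact: cg]. Qed.
Lemma continuous_opp (f : S -> R) : continuous f -> continuous (fun x => - f x).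
Proof. by move=> cf x; apply: cvgN; exact: cf. Qed.
Lemma ccont_cst c : ccont (fun _ => c).
Proof. by split; apply: continuous_const. Qed.
Lemma ccont_mul f g : ccont f -> ccont g -> ccont (fun s => f s * g s).
Proof.
move=> [f1 f2] [g1 g2]; split.
  apply: continuous_ext (fun s => ReM (f s) (g s)) _.
  by apply: continuous_sub; apply: continuous_mul.
apply: continuous_ext (fun s => ImM (f s) (g s)) _.
by apply: continuous_add; apply: continuous_mul.
Qed.
Lemma ccont_conj f : ccont f -> ccont (fun s => (f s)^*).
Proof.
move=> [f1 f2]; split; first by apply: continuous_ext f1 => s; rewrite Re_conj.
by apply: continuous_ext (continuous_opp f2) => s; rewrite conjE.
Qed.
Lemma ccont_sum I (r : seq I) (F : I -> S -> C) :
  (forall i, ccont (F i)) -> ccont (fun s => \sum_(i <- r) F i s).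
Proof.
move=> h; split.
  apply: continuous_ext (fun s => Re_sum r predT (fun i => F i s)) _.
  by apply: continuous_sum => i; case: (h i).
apply: continuous_ext (fun s => Im_sum r predT (fun i => F i s)) _.
by apply: continuous_sum => i; case: (h i).
Qed.
Lemma ccont_ext f g : f =1 g -> ccont g -> ccont f.
Proof. by move=> /funext ->. Qed.

Lemma mcont_cst p q (A : 'M[C]_(p, q)) : mcont (fun _ => A).
Proof. by move=> i j; apply: ccont_cst. Qed.
Lemma mcont_mul p q r (F : S -> 'M[C]_(p, q)) (G : S -> 'M[C]_(q, r)) :
  mcont F -> mcont G -> mcont (fun s => F s *m G s).
Proof.
move=> hF hG i j; apply: ccont_ext (fun s => mxE _ _ _ _) _.
by apply: ccont_sum => l; apply: ccont_mul.
Qed.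
Lemma mcont_mul3 p q r t (F : S -> 'M[C]_(p, q)) (G : S -> 'M[C]_(q, r))
    (H : S -> 'M[C]_(r, t)) :
  mcont F -> mcont G -> mcont H -> mcont (fun s => F s *m G s *m H s).
Proof. by move=> hF hG hH; apply: mcont_mul hH; apply: mcont_mul. Qed.
Lemma mcont_adj p q (F : S -> 'M[C]_(p, q)) : mcont F -> mcont (fun s => adj (F s)).
Proof.
move=> hF i j; apply: ccont_ext (fun s => adjE (F s) i j) _.
exact: ccont_conj.
Qed.
Lemma mcont_sum p q I (r : seq I) (F : I -> S -> 'M[C]_(p, q)) :
  (forall i, mcont (F i)) -> mcont (fun s => \sum_(i <- r) F i s).
Proof.
move=> h i j; apply: ccont_ext (fun s => summxE _ _ _ _ _) _.
by apply: ccont_sum => l; apply: h.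
Qed.
Lemma mcont_rotmx p (A : 'M[C]_p) (th : S -> 'I_p -> R) :
  (forall i, continuous (fun s => th s i)) -> mcont (fun s => rotmx A (th s)).
Proof.
move=> h; apply: mcont_mul; last exact: mcont_cst.
apply: mcont_mul; first exact: mcont_cst.
move=> i j; have [ij|ij] := eqVneq i j; last first.
  apply: ccont_ext (ccont_cst 0) => s; by rewrite !mxE (negPf ij) mulr0n.
apply: (@ccont_ext _ (fun s => cis (th s i))) => [s|].
  by rewrite !mxE ij eqxx mulr1n.
split=> s; apply: (continuous_comp (h i s)); [exact: continuous_cos|exact: continuous_sin].
Qed.
End ContinuousMatrices.

(** * Existence of the universal recovery map *)

Section UniversalRecoveryMap.
Variable R : realType.
Local Notation C := (R[i]).
Local Notation Re := (@complex.Re R).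
Local Notation Im := (@complex.Im R).
Variables (n m k : nat) (N : 'M[C]_n -> 'M[C]_m) (K : 'I_k -> 'M[C]_(m, n)).
Hypothesis NE : forall X, N X = \sum_l K l *m X *m adj (K l).
Hypothesis trN : forall X, \tr (N X) = \tr X.
Variable sigma : 'M[C]_n.
Hypothesis sigma0 : psd sigma.

Definition rotU (u : 'rV[R]_(n + m)) := rotmx (N sigma) (fun i => u 0 (rshift n i)).
Definition rotV (u : 'rV[R]_(n + m)) := rotmx sigma (fun i => u 0 (lshift m i)).
Definition recovery u := rot_petz sigma N (rotU u) (rotV u).

Lemma sandwich_linear p q r s (A : 'M[C]_(p, q)) (B : 'M[C]_(r, s)) c X Y :
  A *m (c *: X + Y) *m B = c *: (A *m X *m B) + A *m Y *m B.
Proof. by rewrite mulmxDr mulmxDl -scalemxAr -scalemxAl. Qed.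
Lemma recovery_linear u : linear_map (recovery u).
Proof.
have ch_lin c (X Y : 'M[C]_m) : ch_adj N (c *: X + Y) = c *: ch_adj N X + ch_adj N Y.
  apply/matrixP=> i j; rewrite !mxE mulmxDr -scalemxAr.
  by rewrite mxtraceD mxtraceZ.
move=> c X Y; rewrite /recovery /rot_petz /petz.
by rewrite sandwich_linear sandwich_linear ch_lin !sandwich_linear.
Qed.
Lemma recovery_sum u X : recovery u X = \sum_a \sum_b X a b *: recovery u (delta_mx a b).
Proof.
rewrite {1}(matrix_sum_delta X) linear_map_sum; last exact: recovery_linear.
apply: eq_bigr => a _; rewrite linear_map_sum; last exact: recovery_linear.
by apply: eq_bigr => b _; rewrite linear_mapZ //; exact: recovery_linear.
Qed.
Lemma recovery_admissible u : admissible_UV sigma N (rotU u) (rotV u).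
Proof.
have hs := psd_adj sigma0; have hN := psd_adj (psd_channel NE sigma0).
by split; [exact: rotmx_unitary|exact: rotmx_comm|exact: rotmx_unitary|exact: rotmx_comm].
Qed.
Lemma recovery_cont (S : topologicalType) (u : S -> 'rV[R]_(n + m)) X :
  (forall l, continuous (fun s => u s 0 l)) -> mcont (fun s => recovery (u s) X).
Proof.
move=> hu; have cU : mcont (fun s => rotU (u s)) by apply: mcont_rotmx => i; apply: hu.
have cV : mcont (fun s => rotV (u s)) by apply: mcont_rotmx => i; apply: hu.
have cst p q (A : 'M[C]_(p, q)) : mcont (fun _ : S => A) := mcont_cst _ A.
have cN (Y : S -> 'M[C]_m) : mcont Y -> mcont (fun s => ch_adj N (Y s)).
  move=> hY; rewrite (_ : (fun _ => _) = fun s => \sum_l adj (K l) *m Y s *m K l).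
    by apply: mcont_sum => l; apply: mcont_mul3; [exact: cst|exact: hY|exact: cst].
  by apply/funext => s; rewrite (ch_adjE NE).
rewrite /recovery /rot_petz /petz.
apply: mcont_mul3; [exact: cV| |exact: mcont_adj].
apply: mcont_mul3; [exact: cst| |exact: cst].
apply: cN; apply: mcont_mul3; [exact: cst| |exact: cst].
by apply: mcont_mul3; [exact: cU|exact: cst|exact: mcont_adj].
Qed.

Local Notation index := ('I_m * 'I_m * ('I_n * 'I_n) * bool)%type.
(** The real features for [minimax]: by linearity the images of the matrix units determine the whole
    map. *)
Definition coordinate (x : index) u : R :=
  let: (a, b, (c, e), z) := x in
  let y := recovery u (delta_mx a b) c e in if z then Re y else Im y.
(** The sign of [Im] comes from Re (y y') = Re y Re y' - Im y Im y'. *)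
Definition coefficient (D : datum sigma) (x : index) : R :=
  let: (a, b, (c, e), z) := x in
  let y := (\sum_x (weight_of D x)%:C%C *: effect D x) e c * N (state D) a b in
  if z then Re y else - Im y.

Lemma test_recovery D u : test D (recovery u (N (state D))) =
  \sum_x coefficient D x * coordinate x u.
Proof.
set Om := \sum_x (weight_of D x)%:C%C *: effect D x.
transitivity (rtr (Om *m recovery u (N (state D)))).
  rewrite /test mulmx_suml rtr_sum; apply: eq_bigr => x _.
  by rewrite -scalemxAl rtrZ.
rewrite recovery_sum mulmx_sumr rtr_sum.
transitivity (\sum_a \sum_b \sum_c \sum_e \sum_z
    coefficient D (a, b, (c, e), z) * coordinate (a, b, (c, e), z) u).
  apply: eq_bigr => a _; rewrite mulmx_sumr rtr_sum; apply: eq_bigr => b _.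
  rewrite -scalemxAr /rtr mxtraceZ mxtrace_mulC /mxtrace mulr_sumr Re_sum.
  apply: eq_bigr => c _; rewrite mxE mulr_sumr Re_sum; apply: eq_bigr => e _.
  rewrite big_bool /= mulNr -ReM; congr Re; rewrite -/Om; ring.
rewrite pair_bigA; under eq_bigr do rewrite pair_bigA.
rewrite pair_bigA pair_bigA /=.
by apply: eq_bigr => -[[[a b] [c e]] z] _.
Qed.

(** [minimax] over the box of angles; its finitely many points and weights are the convex
    combination demanded by [in_recovery_hull]. *)
Theorem universal_recovery : exists Rt : 'M[C]_m -> 'M[C]_n,
  in_recovery_hull sigma N Rt /\
  forall D : datum sigma, level N D <= test D (Rt (N (state D))).
Proof.
pose phi (l : 'I_#|{: index}|) u := coordinate (enum_val l) u.
pose a (D : datum sigma) (l : 'I_#|{: index}|) := coefficient D (enum_val l).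
have gE D u : \sum_l a D l * phi l u = test D (recovery u (N (state D))).
  by rewrite test_recovery [RHS]big_enum_val.
have phi_cont l (S : topologicalType) (u : S -> 'rV[R]_(n + m)) :
    (forall i, continuous (fun s => u s 0 i)) -> continuous (fun s => phi l (u s)).
  move=> hu; rewrite /phi; case: (enum_val l) => -[[b c] [e f]] z /=.
  have [h1 h2] := recovery_cont (delta_mx b c) hu e f.
  by case: z.
have dual q (lam : 'I_q -> R) (D : 'I_q -> datum sigma) x : (forall j, 0 <= lam j) ->
    (forall u : 'rV[R]_(n + m), (forall l, `|u 0 l| <= pi) ->
       \sum_j lam j * (\sum_l a (D j) l * phi l u) <= x) ->
    \sum_j lam j * level N (D j) <= x.
  (* For each t the rotated Petz map is the recovery map at one point u of the box, so a bound on
     the box holds for all t. *)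
  move=> lam0 hx; apply: (family_bound NE trN sigma0 lam0) => t.
  have [th1 th1pi E1] := phasemx_rotmx (N sigma) (- t).
  have [th2 th2pi E2] := phasemx_rotmx sigma t.
  pose u : 'rV[R]_(n + m) := \row_l match split l with inl i => th2 i | inr i => th1 i end.
  have upi l : `|u 0 l| <= pi by rewrite mxE; case: split.
  have E3 : phasemx (- t) (N sigma) = rotU u.
    rewrite E1 /rotU; congr (rotmx _ _); apply/funext => i; rewrite mxE.
    by case: split_ordP => l /eqP; rewrite ?eq_rshift ?eq_rlshift // => /eqP ->.
  have E4 : phasemx t sigma = rotV u.
    rewrite E2 /rotV; congr (rotmx _ _); apply/funext => i; rewrite mxE.
    by case: split_ordP => l /eqP; rewrite ?eq_lshift ?eq_lrshift // => /eqP ->.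
  apply: le_trans (hx u upi); apply: ler_sum => j _.
  by apply: ler_wpM2l => //; rewrite gE /petz_rot E3 E4.
have [p [s [p0 p1 _ hs]]] := minimax (pi_ge0 R) phi_cont dual.
exists (fun X => \sum_j (p j)%:C%C *: recovery (s j) X); split.
  exists #|{: index}|.+1, p, (fun j => rotU (s j)), (fun j => rotV (s j)).
  by split=> // j; apply: recovery_admissible.
move=> D; apply: le_trans (hs D) _; rewrite /test.
under [leRHS]eq_bigr do rewrite mulmx_sumr rtr_sum mulr_sumr.
rewrite [leRHS]exchange_big /=; apply: ler_sum => j _; rewrite gE /test mulr_sumr.
by apply: ler_sum => x _; rewrite -scalemxAr rtrZ mulrCA.
Qed.
End UniversalRecoveryMap.

(** * Measured relative entropy and its variational form *)

Section Measurements.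
Variable R : realType.
Local Notation C := (R[i]).

Lemma tr_gram p q (X : 'M[C]_(p, q)) : \tr (X *m adj X) = (fro X)%:C%C.
Proof.
rewrite froE rmorph_sum /=; apply: eq_bigr => i _.
rewrite mxE rmorph_sum /=; apply: eq_bigr => j _.
by rewrite adjE mul_conjE.
Qed.
Lemma rtr_mul_psd n (A B : 'M[C]_n) : psd A -> psd B ->
  rtr (A *m B) = fro (hpow 1 0 A *m hpow 1 0 B).
Proof.
by move=> A0 B0; rewrite fro_mulsqrt // adj_hpow0 [RHS]rtrC mulmxA hpow1K.
Qed.
Lemma tr_mul_psd n (A B : 'M[C]_n) : psd A -> psd B ->
  \tr (A *m B) = (rtr (A *m B))%:C%C.
Proof.
move=> A0 B0; rewrite rtr_mul_psd // -tr_gram adjM !adj_hpow0.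
by rewrite !mulmxA -(mulmxA (hpow 1 0 A) (hpow 1 0 B)) hpow1K // [RHS]mxtrace_mulC mulmxA hpow1K.
Qed.

Definition real_diag k (p : 'I_k -> R) : 'M[C]_k := diag_mx (\row_x (p x)%:C%C).

Lemma measure_chE n k (M : 'I_k -> 'M[C]_n) rho : povm M -> psd rho ->
  measure_ch M rho = real_diag (fun x => rtr (rho *m M x)).
Proof.
move=> [M0 _] rho0; congr diag_mx; apply/rowP=> x; rewrite !mxE.
exact: tr_mul_psd.
Qed.

Lemma mxlog_real_diag k (p : 'I_k -> R) :
  mxlog (real_diag p) = real_diag (fun x => ln (p x)).
Proof.
have h : adj (real_diag p) = real_diag p.
  rewrite adj_diag; congr diag_mx; apply/rowP=> x; rewrite !mxE.
  exact: conj_real_complex.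
rewrite /mxlog (@mxfun_diag_unique R k _ _ 1%:M (\row_x (p x)%:C%C)) //.
- rewrite adj1 mul1mx mulmx1; congr diag_mx; apply/rowP=> x; rewrite !mxE /logC ltcR.
  (* [ln] is 0 off the positive reals, in agreement with [logC]. *)
  by case: ltP => // px; rewrite ln0.
- by rewrite adj1 mul1mx.
- by rewrite adj1 mul1mx mulmx1.
Qed.

Lemma supp_le_real_diag k (p q : 'I_k -> R) :
  supp_le (real_diag p) (real_diag q) <-> forall x, q x = 0 -> p x = 0.
Proof.
split=> [h x qx|h v].
  have /h /matrixP /(_ x 0) : real_diag q *m delta_mx x 0 = 0 :> 'cV_k.
    apply/matrixP=> i j; rewrite mul_diag_mx !mxE.
    by have [->|] := eqVneq i x; rewrite ?qx ?mul0r ?mulr0.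
  by rewrite mul_diag_mx !mxE !eqxx mulr1 => -[].
move=> /matrixP qv; apply/matrixP=> i j; have := qv i j; rewrite !mul_diag_mx !mxE.
move/eqP; rewrite mulf_eq0 => /orP[/eqP[/h ->]|/eqP ->]; first by rewrite mul0r.
by rewrite mulr0.
Qed.

Lemma relent_real_diag k (p q : 'I_k -> R) :
  relent (real_diag p) (real_diag q) =
  if `[< forall x, q x = 0 -> p x = 0 >]
  then (\sum_x p x * (ln (p x) - ln (q x)))%:E else +oo%E.
Proof.
rewrite /relent (asbool_equiv_eq (supp_le_real_diag p q)); case: ifP => // _.
congr (_%:E); rewrite !mxlog_real_diag /mxtrace Re_sum; apply: eq_bigr => x _.
by rewrite mul_diag_mx !mxE !eqxx !mulr1n ReZ.
Qed.

Lemma sum_rtr_povm n k (M : 'I_k -> 'M[C]_n) rho : povm M ->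
  \sum_x rtr (rho *m M x) = rtr rho.
Proof. by case=> _ M1; rewrite -rtr_sum -mulmx_sumr M1 mulmx1. Qed.

(* The optimal weights are the likelihood ratios p x / q x. *)
Lemma weighted_log_bound k (p q : 'I_k -> R) (a : R) :
  (forall x, 0 <= p x) -> (forall x, 0 <= q x) -> \sum_x p x = 1 ->
  (forall w : 'I_k -> R, (forall x, 0 < w x) ->
     \sum_x ln (w x) * p x - a + 1 <= \sum_x w x * q x) ->
  (forall x, q x = 0 -> p x = 0) /\ \sum_x p x * (ln (p x) - ln (q x)) <= a.
Proof.
move=> p0 q0 p1 h; pose Q := \sum_x q x; have Q0 : 0 <= Q by apply: sumr_ge0.
have qp x : q x = 0 -> p x = 0.
  move=> qx; apply/eqP; rewrite eq_le p0 andbT leNgt; apply/negP => px.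
  (* The weight at x costs nothing as q x = 0, and it is chosen so that its logarithmic term equals
     Q + a: the hypothesis becomes Q + 1 <= Q. *)
  pose w y := if y == x then expR ((Q + a) / p x) else 1.
  have w0 y : 0 < w y by rewrite /w; case: ifP => // _; apply: expR_gt0.
  have := h w w0; rewrite (bigD1 x) //= big1 ?addr0 => [|y /negPf yx]; last first.
    by rewrite /w yx ln1 mul0r.
  rewrite (bigD1 x) //= qx mulr0 add0r.
  rewrite (eq_bigr q) => [|y /negPf yx]; last by rewrite /w yx mul1r.
  rewrite {1}/w eqxx expRK divfK ?gt_eqF //.
  rewrite (_ : \sum_(i < k | i != x) q i = Q); first by lra.
  by rewrite /Q [RHS](bigD1 x) //= qx add0r.
split=> //; apply/ler_addgt0Pr => e e0.
have Q1 : 0 < Q + 1 by rewrite ltr_wpDl.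
(* Weights must be positive, so 0 is replaced by e / (Q + 1) where p vanishes, at a total cost of at
   most e. *)
pose w x := if 0 < p x then p x / q x else e / (Q + 1).
have q_gt0 x : 0 < p x -> 0 < q x.
  by move=> px; rewrite lt_def q0 andbT; apply/eqP => /qp E; move: px; rewrite E ltxx.
have w0 x : 0 < w x by rewrite /w; case: ifP => [px|_]; rewrite divr_gt0 // q_gt0.
have := h w w0.
rewrite (eq_bigr (fun x => p x * (ln (p x) - ln (q x)))) => [|x _]; last first.
  rewrite /w; case: ifP => [px|/negbT]; first by rewrite ln_div ?posrE ?q_gt0 // mulrC.
  by rewrite -leNgt => px; rewrite (_ : p x = 0) ?mulr0 ?mul0r //; apply/eqP; rewrite eq_le px p0.
have : \sum_x w x * q x <= \sum_x (p x + e / (Q + 1) * q x).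
  apply: ler_sum => x _; rewrite /w; case: ifP => [px|_].
    by rewrite divfK ?gt_eqF ?q_gt0 // lerDl mulr_ge0 // divr_ge0 // ltW.
  by rewrite lerDr.
rewrite big_split /= p1 -mulr_sumr -/Q.
have : e / (Q + 1) * Q <= e by rewrite mulrAC ler_pdivrMr // ler_wpM2l ?(ltW e0) // lerDl.
lra.
Qed.

(** Rests on the classical formula that D(p||q) is the supremum over w > 0 of sum p ln w + 1 - sum w
    q, applied to each measurement. *)
Lemma meas_relent_le n (rho tau : 'M[C]_n) (a : R) : density rho -> psd tau ->
  (forall k (M : 'I_k -> 'M[C]_n) (w : 'I_k -> R), povm M -> (forall x, 0 < w x) ->
     \sum_x ln (w x) * rtr (rho *m M x) - a + 1 <= \sum_x w x * rtr (M x *m tau)) ->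
  (meas_relent rho tau <= a%:E)%E.
Proof.
move=> [rho0 rho1] tau0 h; apply: ge_ereal_sup => _ [k [M [pM ->]]].
rewrite !measure_chE // relent_real_diag.
have [M0 _] := pM.
have [] := @weighted_log_bound k (fun x => rtr (rho *m M x)) (fun x => rtr (tau *m M x)) a.
- by move=> x; rewrite (rtr_mul_psd rho0 (M0 x)) fro_ge0.
- by move=> x; rewrite (rtr_mul_psd tau0 (M0 x)) fro_ge0.
- by rewrite sum_rtr_povm // /rtr rho1.
- by move=> w w0; under [leRHS]eq_bigr do rewrite rtrC; apply: h.
by move=> /asboolT -> ; rewrite lee_fin.
Qed.
End Measurements.

(** * The fidelity bound *)

Section Fidelity.
Variable R : realType.
Local Notation C := (R[i]).
Local Notation Re := (@complex.Re R).

Definition eigenproj n (A : 'M[C]_n) (x : 'I_n) : 'M[C]_n :=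
  adj (spectralmx A) *m delta_mx x x *m spectralmx A.

Lemma eigenproj_povm n (A : 'M[C]_n) : povm (eigenproj A).
Proof.
split=> [x|].
  rewrite /eigenproj -[X in _ *m X]adjK; apply: psd_conj.
  have -> : delta_mx x x = delta_mx x x *m adj (delta_mx x x) :> 'M[C]_n.
    apply/matrixP=> i j; rewrite [RHS]mxE (bigD1 x) //= big1 => [|y /negPf yx].
      by rewrite addr0 adjE !mxE eqxx !andbT rmorph_nat -natrM mulnb.
    by rewrite mxE yx andbF mul0r.
  exact: psd_gramC.
rewrite /eigenproj -mulmx_suml -mulmx_sumr.
rewrite (_ : \sum_x _ = 1%:M) ?mulmx1 ?spectralmxK //.
apply/matrixP=> i j; rewrite summxE (bigD1 i) //= !mxE eqxx big1 ?addr0 /=.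
  by rewrite eq_sym.
by move=> y /negPf yi; rewrite mxE eq_sym yi.
Qed.
Lemma mul_eigenproj n (A : 'M[C]_n) x : psd A ->
  A *m eigenproj A x = (Re (spectral_diag A 0 x))%:C%C *: eigenproj A x /\
  eigenproj A x *m A = (Re (spectral_diag A 0 x))%:C%C *: eigenproj A x.
Proof.
move=> A0; rewrite -ge0_ReE ?spectral_diag_ge0 //.
have AE : A = adj (spectralmx A) *m diag_mx (spectral_diag A) *m spectralmx A.
  by rewrite -[LHS](mxfun_id (psd_adj A0)) mxfunE map_mx_id.
split.
  rewrite [X in X *m _ = _]AE /eigenproj (conj_mul _ _ (spectralmxKV A)).
  rewrite scalemxAl scalemxAr; congr (_ *m _ *m _).
  apply/matrixP=> i j; rewrite mul_diag_mx !mxE.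
  by have [->|] := eqVneq i x; rewrite //= !mulr0.
rewrite [X in _ *m X = _]AE /eigenproj (conj_mul _ _ (spectralmxKV A)).
rewrite scalemxAl scalemxAr; congr (_ *m _ *m _).
apply/matrixP=> i j; rewrite mul_mx_diag !mxE mulrC.
by have [->|] := eqVneq j x; rewrite ?andbF //= !mulr0.
Qed.

(** Jensen's inequality for the logarithm. As p = l^2 q, the sum of l q is the Bhattacharyya
    coefficient, and p ln (p / q) is 2 p ln l. *)
Lemma bhattacharyya_bound k (p q l : 'I_k -> R) :
  (forall x, 0 <= q x) -> (forall x, 0 <= l x) -> (forall x, p x = l x ^+ 2 * q x) ->
  \sum_x p x = 1 -> 0 < \sum_x l x * q x /\
  -2 * ln (\sum_x l x * q x) <= \sum_x p x * (ln (p x) - ln (q x)).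
Proof.
move=> q0 l0 pE p1; set F := \sum_x _.
have F0 : 0 <= F by apply: sumr_ge0 => x _; rewrite mulr_ge0.
have Fgt0 : 0 < F.
  rewrite lt_def F0 andbT; apply/eqP => /eqP; rewrite psumr_eq0 => [/allP h|x _]; last first.
    by rewrite mulr_ge0.
  move/eqP: p1; rewrite big1 => [|x _]; first by rewrite eq_sym oner_eq0.
  have := h x; rewrite mem_index_enum => /(_ isT) /= /eqP lq.
  by rewrite pE expr2 -mulrA lq mulr0.
split=> //.
(* Termwise this is ln y <= y - 1 at y = 1 / (l F), multiplied by 2 p; the correction terms 2 and 2
   / F * (l q) cancel in the sum. *)
apply: (@le_trans _ _ (\sum_x (p x * (-2 * ln F + 2) - 2 / F * (l x * q x)))).
  rewrite sumrB -mulr_suml p1 mul1r -mulr_sumr -/F divfK ?gt_eqF //; lra.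
apply: ler_sum => x _; rewrite pE.
have [->|lx] := eqVneq (l x) 0.
  by rewrite expr2 !mul0r mulr0 subrr.
have [->|qx] := eqVneq (q x) 0; first by rewrite !mulr0 !mul0r subrr.
have lgt : 0 < l x by rewrite lt_def lx l0.
have qgt : 0 < q x by rewrite lt_def qx q0.
rewrite lnM ?posrE ?exprn_gt0 // addrK lnXn //.
have lF : 0 < (l x * F)^-1 by rewrite invr_gt0 mulr_gt0.
have hy : -1 < (l x * F)^-1 - 1 by lra.
have := le_ln1Dx hy; rewrite [1 + _]addrC subrK.
rewrite lnV ?posrE ?mulr_gt0 // lnM ?posrE // => hln.
have w0 : 0 <= l x ^+ 2 * q x by rewrite mulr_ge0 ?sqr_ge0.
have := ler_wpM2l w0 hln.
have -> : l x ^+ 2 * q x * ((l x * F)^-1 - 1) = F^-1 * (l x * q x) - l x ^+ 2 * q x.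
  by field; rewrite lx gt_eqF.
lra.
Qed.

(** Measuring whether the state lies in the support of tau gives an outcome of probability 0 for
    tau; were it null for rho too, rho would vanish on the kernel of tau. *)
Lemma meas_relent_not_supp n (rho tau : 'M[C]_n) : psd rho -> psd tau ->
  ~ supp_le rho tau -> meas_relent rho tau = +oo%E.
Proof.
move=> rho0 tau0 nsupp; apply/eqP; rewrite eq_le leey /=.
pose P := suppmx tau; pose M (x : 'I_2) := if x == ord0 then P else 1%:M - P.
have pP : psd P by rewrite -[P]suppmx_proj; apply: psd_gramC.
have pPC : psd (1%:M - P) by rewrite -[X in psd X]suppmxC_proj; apply: psd_gramC.
have pM : povm M.
  split=> [x|]; first by rewrite /M; case: ifP.
  by rewrite big_ord_recl big_ord1 /M /= addrC subrK.
have : (relent (measure_ch M rho) (measure_ch M tau) <= meas_relent rho tau)%E.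
  by apply: ereal_sup_ubound; exists 2%N, M.
rewrite !measure_chE // relent_real_diag asboolF // => h; apply: nsupp.
have t1 : rtr (tau *m M ord_max) = 0.
  by rewrite /M /= mulmxBr mulmx1 mul_suppmx // subrr /rtr mxtrace0.
have := h _ t1; rewrite /M /= -/P; set P' := 1%:M - P.
have aP' : adj P' = P' by rewrite adjB adj1 adj_suppmx.
have PP' : P' *m P' = P' by rewrite -{2}aP'; apply: suppmxC_proj.
have -> : rtr (rho *m P') = fro (P' *m hpow 1 0 rho).
  by rewrite fro_mulsqrt // aP' [RHS]rtrC mulmxA PP' rtrC.
move=> /fro_eq0 /(congr1 (@adj _ _ _)); rewrite adjM adj_hpow0 aP' adj0 => hP v tv.
have Pv : P *m v = 0.
  have -> : P = hpow (-2) 0 tau *m tau.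
    by rewrite -[X in _ = _ *m X](hpow2 tau0) hpowM addNr addr0.
  by rewrite -mulmxA tv mulmx0.
have -> : v = P' *m v by rewrite mulmxBl mul1mx Pv subr0.
by rewrite -(hpow1K rho0) -mulmxA (mulmxA _ P') hP mul0mx mulmx0.
Qed.

(* Fuchs-Caves measurement: T = tau^(-1/2) (tau^(1/2) rho tau^(1/2))^(1/2) tau^(-1/2)
   satisfies T tau T = rho, and in its eigenbasis p x = (l x)^2 q x. *)
Lemma fidelity_le_meas n (rho tau : 'M[C]_n) : density rho -> psd tau ->
  (neg2logF rho tau <= meas_relent rho tau)%E.
Proof.
move=> [rho0 rho1] tau0.
have [supp|/(meas_relent_not_supp rho0 tau0) ->] := pselect (supp_le rho tau); last exact: leey.
pose h := hpow 1 0 tau; pose hN := hpow (-1) 0 tau; pose P := h *m rho *m h.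
have hh : adj h = h by exact: adj_hpow0.
have P0 : psd P by rewrite /P -[X in _ *m X]hh; apply: psd_conj.
pose G := hpow 1 0 P; have G0 : psd G.
  by rewrite /G -(mxsqrtE P0); apply: psd_mxsqrt.
have FE : fidelity rho tau = rtr G.
  rewrite /fidelity /trnorm (mxsqrtE rho0) (mxsqrtE tau0) adjM !adj_hpow0.
  have -> : hpow 1 0 tau *m hpow 1 0 rho *m (hpow 1 0 rho *m hpow 1 0 tau) = P.
    by rewrite mulmxA -(mulmxA (hpow 1 0 tau)) (hpow1K rho0).
  by rewrite mxsqrtE.
have PS : P *m (1%:M - suppmx tau) = 0.
  by rewrite /P -mulmxA mulmxBr mulmx1 hpow_suppmx subrr mulmx0.
have GG : G *m G = P by exact: hpow1K.
have aG : adj G = G by exact: adj_hpow0.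
(* The inverse square root of tau inverts only on the support, so G must live there for the
   projections to cancel. *)
have GS : G *m suppmx tau = G.
  suff /fro_eq0 /eqP : fro (G *m (1%:M - suppmx tau)) = 0.
    by rewrite mulmxBr mulmx1 subr_eq0 => /eqP.
  by rewrite fro_gram adjM aG -mulmxA (mulmxA G) GG PS mulmx0 /rtr mxtrace0.
have SG : suppmx tau *m G = G.
  by have := congr1 (@adj _ _ _) GS; rewrite adjM adj_suppmx aG.
pose T := hN *m G *m hN.
have T0 : psd T.
  by rewrite /T -[X in _ *m X](adj_hpow0 tau (-1)); apply: psd_conj.
have htN : hN *m tau *m hN = suppmx tau.
  by rewrite -[X in _ *m X *m _](hpow2 tau0) /hN !hpowM !addr0 (_ : -1 + 2 + -1 = 0) //; lra.
have TtT : T *m tau *m T = rho.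
  have -> : T *m tau *m T = hN *m (G *m (hN *m tau *m hN) *m G) *m hN.
    by rewrite /T !mulmxA.
  rewrite htN GS GG.
  have -> : hN *m P *m hN = (hN *m h) *m rho *m (h *m hN) by rewrite /P !mulmxA.
  rewrite /hN /h !hpowM addNr subrr addr0 -/(suppmx tau).
  rewrite -mulmxA supp_le_suppmx //.
  have := congr1 (@adj _ _ _) (supp_le_suppmx tau0 supp).
  by rewrite adjM adj_suppmx psd_adj.
(* Identifies the Bhattacharyya coefficient of the outcome distributions, which is the trace of T
   tau, with the fidelity. *)
have trTt : rtr (T *m tau) = rtr G.
  have -> : T *m tau = hN *m G *m (hN *m tau) by rewrite /T mulmxA.
  by rewrite rtrC mulmxA htN SG.
pose l x := Re (spectral_diag T 0 x); pose M := eigenproj T.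
have [M0 M1] := eigenproj_povm T.
pose q x := rtr (tau *m M x); pose p x := rtr (rho *m M x).
have l0 x : 0 <= l x by apply: ge0_Re; apply: spectral_diag_ge0.
have q0 x : 0 <= q x by rewrite /q (rtr_mul_psd tau0 (M0 x)) fro_ge0.
have pE x : p x = l x ^+ 2 * q x.
  have [TM MT] := mul_eigenproj x T0.
  rewrite /p -TtT -mulmxA TM -scalemxAr rtrZ -/(l x) -mulmxA rtrC -mulmxA MT.
  by rewrite -scalemxAr rtrZ mulrA expr2.
have p1 : \sum_x p x = 1 by rewrite sum_rtr_povm /rtr ?rho1 //; exact: eigenproj_povm.
have lq : \sum_x l x * q x = rtr G.
  rewrite -trTt -[T in RHS]mulmx1 -M1 mulmx_sumr mulmx_suml rtr_sum; apply: eq_bigr => x _.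
  by have [-> _] := mul_eigenproj x T0; rewrite -scalemxAl rtrZ (rtrC _ tau).
have [F0 Fle] := bhattacharyya_bound q0 l0 pE p1.
rewrite /neg2logF FE -lq F0.
have : (relent (measure_ch M rho) (measure_ch M tau) <= meas_relent rho tau)%E.
  by apply: ereal_sup_ubound; exists n, M; split=> //; apply: eigenproj_povm.
apply: le_trans; rewrite !measure_chE //; try exact: eigenproj_povm.
rewrite relent_real_diag asboolT ?lee_fin // => x qx.
by rewrite -/(p x) pE [q x]qx mulr0.
Qed.
End Fidelity.

Lemma psd_recovery_hull (R : realType) n m k (N : 'M[R[i]]_n -> 'M[R[i]]_m)
    (K : 'I_k -> 'M[R[i]]_(m, n)) (sigma : 'M[R[i]]_n) Rt X :
  (forall X, N X = \sum_l K l *m X *m adj (K l)) -> psd sigma ->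
  in_recovery_hull sigma N Rt -> psd X -> psd (Rt X).
Proof.
move=> NE sigma0 [q [p [Us [Vs [p0 _ _ ->]]]]] X0; apply: psd_sum => i _.
apply: psdZ => //; apply: psd_conj; rewrite /petz.
rewrite (mxsqrtE sigma0) mxinvsqrtE.
rewrite -[X in _ *m X](adj_hpow0 sigma 1); apply: psd_conj.
apply: (psd_ch_adj NE); rewrite -[X in _ *m X](adj_hpow0 (N sigma) (-1)).
by apply: psd_conj; apply: psd_conj.
Qed.

Lemma relentE (R : realType) n (rho sigma : 'M[R[i]]_n) : supp_le rho sigma ->
  relent rho sigma = (rtr (rho *m (hlog rho - hlog sigma)))%:E.
Proof. by move=> h; rewrite /relent asboolT // !hlog.unlock. Qed.

Theorem theorem2 (R : realType) (n m : nat) (sigma : 'M[R[i]]_n)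
    (N : 'M[R[i]]_n -> 'M[R[i]]_m) :
  psd sigma -> tpcp N ->
  exists Rt : 'M[R[i]]_m -> 'M[R[i]]_n,
    in_recovery_hull sigma N Rt /\
    forall rho : 'M[R[i]]_n, density rho -> supp_le rho sigma ->
      ((relent rho sigma - relent (N rho) (N sigma))%E
         >= meas_relent rho (Rt (N rho)))%E /\
      (meas_relent rho (Rt (N rho)) >= neg2logF rho (Rt (N rho)))%E.
Proof.
move=> sigma0 Ntpcp; have [k [K NE]] := kraus_decomposition Ntpcp.
case: Ntpcp => _ trN _.
have [Rt [hull bound]] := universal_recovery NE trN sigma0.
exists Rt; split=> // rho rho_d supp; have [rho0 _] := rho_d.
have Nrho0 := psd_channel NE rho0.
have tau0 := psd_recovery_hull NE sigma0 hull Nrho0.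
split; last exact: fidelity_le_meas.
(* Both relative entropies are finite, so their difference is that of two real numbers. *)
rewrite (relentE supp) (relentE (supp_le_channel NE rho0 sigma0 supp)) -EFinB.
apply: meas_relent_le => // r M w pM w0.
exact: (bound (Datum rho_d supp pM w0)).
Qed.
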